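(* Let $\mathcal{D}=\mathbb{C}[\partial_1,\partial_3,\partial_5,\ldots]$ act on $A$, and let $\mathrm{ev}_1:\mathcal{D}\otimes\mathbb{C}[\bar S_2,\bar S_4,\ldots]\to A$ and $\mathrm{ev}_2:\mathcal{D}\otimes\tilde H^\ast_{-1}\to A$ be the $\mathcal{D}$-linear maps defined in the context. Then $\mathrm{ev}_1$ is surjective if and only if $\mathrm{ev}_2$ is surjective.
   Context: The KdV ring. Let $A=\mathbb{C}[u^{(0)},u^{(1)},u^{(2)},\ldots]$ be the polynomial ring in infinitely many variables, $u=u^{(0)}$, with the derivation $'$ given by $(u^{(m)})'=u^{(m+1)}$. Define $S_2,S_4,\ldots\in A$ (elements without constant term) recursively by $S_2=-\frac12 u$ and $S_{n+2}'=\frac14 S_n'''-uS_n'-\frac12 u'S_n$ for $n=2,4,\ldots$. For odd $n\ge1$ let $\partial_n$ be the derivation of $A$ with $\partial_n(u^{(k)})=(S_{n+1})^{(k+1)}$ (the $(k+1)$-fold $'$-derivative); these commute (the KdV hierarchy), $\partial_1={}'$, and $A$ is a module over $\mathcal{D}=\mathbb{C}[\partial_1,\partial_3,\ldots]$. For odd $i,j\ge1$ let $\zeta_{ij}\in A$ be $\partial_i\partial_j\log\tau$ ($\tau$ the KdV tau function) written as a differential polynomial in $u$; equivalently, $\zeta_{ij}$ is the element of $A$ with zero constant term satisfying $\partial_1\zeta_{ij}=\partial_i(S_{j+1})$; in particular $\zeta_{1,2n-1}=S_{2n}$. The map $\mathrm{ev}_1$. Let $\bar S_{2n}$ be polynomials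 in commuting variables $J_2,J_4,\ldots$ defined by $\exp(-\sum_{k\ge1}\frac1k J_{2k}z^{-2k})=\sum_{n\ge0}\bar S_{2n}z^{-2n}$; then $\mathbb{C}[J_2,J_4,\ldots]=\mathbb{C}[\bar S_2,\bar S_4,\ldots]$. Define $\mathrm{ev}_1(P\otimes \bar S_2^{a_2}\bar S_4^{a_4}\cdots)=P(S_2^{a_2}S_4^{a_4}\cdots)$ for $P\in\mathcal{D}$, extended linearly. The map $\mathrm{ev}_2$. Let $\tilde\psi_n,\tilde\psi^\ast_n$ ($n\in2\mathbb{Z}+1$) satisfy $[\tilde\psi_m,\tilde\psi_n]_+=[\tilde\psi^\ast_m,\tilde\psi^\ast_n]_+=0$, $[\tilde\psi^\ast_m,\tilde\psi_n]_+=\delta_{mn}$, where $[X,Y]_+=XY+YX$. For odd $m$ the bra vacuum $\langle m|$ satisfies $\langle m|\tilde\psi_n=0$ for $n\le m$, $\langle m|\tilde\psi^\ast_n=0$ for $n>m$, and $\langle m-2|\tilde\psi_m=\langle m|$. $\tilde H^\ast_m$ is the Fock space of bra vectors obtained from $\langle m|$ by right multiplication with products containing equal numbers of $\tilde\psi$'s and $\tilde\psi^\ast$'s. Put $\alpha_i=\tilde\psi_{-i}$, $\beta_i=\tilde\psi_i$ for odd $i\ge1$. For $N\ge0$, $0\le k\le N$, odd integers $2N+1>i_{N-k}>\cdots>i_1\ge1$ and odd $j_k>\cdots>j_1\ge1$, the vectors $v=\langle -2N-1|\alpha_{i_{N-k}}\cdots\alpha_{i_1}\beta_{j_k}\cdots\beta_{j_1}$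 lie in $\tilde H^\ast_{-1}$ and, over all $N$, span it. Let $I=(i_{N-k},\ldots,i_1)$, $\{l_k>\cdots>l_1\}=\{1,3,\ldots,2N-1\}\setminus I$, and $\mathrm{sgn}(I,I^c)$ the sign of the permutation taking $(2N-1,\ldots,3,1)$ to $(i_{N-k},\ldots,i_1,l_k,\ldots,l_1)$. Then $\mathrm{ev}_2$ is the $\mathcal{D}$-linear map with $\mathrm{ev}_2(P\otimes v)=P\big(\mathrm{sgn}(I,I^c)\det(\zeta_{l_aj_b})_{1\le a,b\le k}\big)$ (determinant $=1$ if $k=0$); this is independent of the choice of $N$ under the identification $\langle-2N-1|a=\langle -2N'-1|\alpha_{2N'-1}\alpha_{2N'-3}\cdots\alpha_{2N+1}a$ for $N<N'$. Equivalently, writing $\mathrm{vol}=\cdots\wedge dt_5\wedge dt_3\wedge dt_1$ and $d\zeta_j=\sum_{m\text{ odd}}\zeta_{jm}dt_m$, $\mathrm{ev}_2(P\otimes v)\,\mathrm{vol}=P(\cdots\wedge dt_{2N+3}\wedge dt_{2N+1}\wedge dt_{i_{N-k}}\wedge\cdots\wedge dt_{i_1}\wedge d\zeta_{j_k}\wedge\cdots\wedge d\zeta_{j_1})$. *)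

(* Defs.v *)
From HB Require Import structures.
From mathcomp Require Import all_boot all_order all_algebra.
From mathcomp Require Import finmap.
From mathcomp Require Import monalg complex.
From Stdlib Require Import ClassicalEpsilon.

Set Implicit Arguments.
Unset Strict Implicit.
Unset Printing Implicit Defensive.

Import Order.TTheory GRing.Theory Num.Theory.
Local Open Scope ring_scope.

Section KdV.
(* The base field: C = R[i] for a real closed field R (R = the reals gives C). *)
Variable R : rcfType.
Local Notation C := (complex R).

(* The KdV ring A = C[u^(0), u^(1), ...]: the monoid algebra of commutative
   monomials in the variables indexed by nat. *)
Definition KdVring := {malg C[{cmonom nat}]}.
Local Notation A := {malg C[{cmonom nat}]}.

Definition uvar (k : nat) : A := << ucm k >>.

(* the derivation of A determined by its values f k on the generators u^(k):
   D (sum_m c_m x^m) = sum_m c_m sum_i m(i) x^(m - e_i) f(i) *)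
Definition deriv_by (f : nat -> A) (g : A) : A :=
  \sum_(m <- msupp g) g@_m *:
     \sum_(i <- finsupp (cmonom_val m)) ((cmonom_val m i)%:R *:
          (<< divcm m (ucm i) >> * f i)).

Definition prime : A -> A := deriv_by (fun k => uvar k.+1).

Definition const_term (a : A) : C := a@_(@onecm nat).

(* For a derivation d: the element b with zero constant term and d b = a
   (chosen by classical choice when it exists; it is then unique in the cases
   used below; 0 otherwise). *)
Definition antider (d : A -> A) (a : A) : A :=
  match excluded_middle_informative (exists b : A, const_term b = 0 /\ d b = a) with
  | left h => proj1_sig (constructive_indefinite_description _ h)
  | right _ => 0
  end.

(* Sseq k = S_{2k+2}:  S_2 = -1/2 u,
   S_{n+2}' = 1/4 S_n''' - u S_n' - 1/2 u' S_n, S_{n+2} without constant term *)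
Fixpoint Sseq (k : nat) : A :=
  match k with
  | 0 => - ((2%:R)^-1 *: uvar 0)
  | k'.+1 =>
      let s := Sseq k' in
      antider prime ((4%:R)^-1 *: prime (prime (prime s))
                     - uvar 0 * prime s - (2%:R)^-1 *: (uvar 1 * s))
  end.

(* S n = S_n for even n >= 2 *)
Definition S (n : nat) : A := Sseq (n./2).-1.

Definition dflow (n : nat) : A -> A :=
  deriv_by (fun k => iter k.+1 prime (S n.+1)).

Definition zeta (i j : nat) : A := antider (dflow 1) (dflow i (S j.+1)).

(* the action of the monomial d_{p_1} ... d_{p_r} of D on A *)
Definition Dact (P : seq nat) (a : A) : A := foldr dflow a P.

Definition Dmon (P : seq nat) : bool := all odd P.

(* Generators P (x) Sbar_2^{a_0} Sbar_4^{a_1} ... of D (x) C[Sbar_2, Sbar_4,...],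
   indexed by (P, a) with a = [a_0; a_1; ...] the exponents. *)
Definition ev1_gen (x : seq nat * seq nat) : A :=
  Dact x.1 (\prod_(t < size x.2) S (t.*2.+2) ^+ nth 0%N x.2 t).

Definition ev1 (l : seq (C * (seq nat * seq nat))) : A :=
  \sum_(p <- l) p.1 *: ev1_gen p.2.

Definition ev1_surjective : Prop :=
  forall x : A, exists l, all (fun p => Dmon p.2.1) l /\ ev1 l = x.

(* The spanning vectors <-2N-1| alpha_{i_{N-k}} ... alpha_{i_1} beta_{j_k} ... beta_{j_1}
   of H*_{-1}, indexed by (N, I, J), I = [i_{N-k}; ...; i_1], J = [j_k; ...; j_1]. *)
Definition valid_v (v : nat * seq nat * seq nat) : bool :=
  let: (N, Is, Js) := v in
  [&& sorted (fun x y => y < x)%N Is, all odd Is, all (fun i => i < N.*2.+1)%N Is,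
      sorted (fun x y => y < x)%N Js, all odd Js & (size Is + size Js == N)%N].

Definition odds_desc (N : nat) : seq nat := rev (mkseq (fun t => t.*2.+1) N).

Definition compl_desc (N : nat) (I : seq nat) : seq nat :=
  [seq l <- odds_desc N | l \notin I].

(* sign of the permutation taking the decreasing sequence (2N-1,...,1) to s:
   (-1)^(number of inversions of s w.r.t. the decreasing order) *)
Definition ninv (s : seq nat) : nat :=
  \sum_(p < size s) \sum_(q < size s | (p < q)%N) (nth 0%N s p < nth 0%N s q)%N.

Definition sgnIIc (N : nat) (I : seq nat) : C :=
  (-1) ^+ ninv (I ++ compl_desc N I).

(* det(zeta_{l_a j_b})_{1<=a,b<=k}, with l_1 < ... < l_k and j_1 < ... < j_k *)
Definition zeta_det (L J : seq nat) : A :=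
  let Li := rev L in let Ji := rev J in
  \det (\matrix_(a < size J, b < size J) zeta (nth 0%N Li a) (nth 0%N Ji b)).

Definition ev2_gen (x : seq nat * (nat * seq nat * seq nat)) : A :=
  let: (P, (N, Is, Js)) := x in
  Dact P (sgnIIc N Is *: zeta_det (compl_desc N Is) Js).

Definition ev2 (l : seq (C * (seq nat * (nat * seq nat * seq nat)))) : A :=
  \sum_(p <- l) p.1 *: ev2_gen p.2.

Definition ev2_surjective : Prop :=
  forall x : A, exists l, all (fun p => Dmon p.2.1 && valid_v p.2.2) l /\ ev2 l = x.

End KdV.

(* Main.v *)
From HB Require Import structures.
Require Import Defs.
From mathcomp Require Import all_boot all_order all_algebra.
From mathcomp Require Import finmap fingroup perm.
From mathcomp Require Import monalg complex ring zify.
From mathcomp Require Import boolp.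

(**
Write s_n = S_(2n), s = 1 + sum_n s_n z^(-2n) and r = 1/s. The quadratic relation
4 z^2 (s^2 - 1) = 2 s s'' - s'^2 - 4 u s^2 determines s, and its linearization
gives the flows of s and of r: the coefficients h_(n,m) of
(s(w) r(z) - 1) / (z^2 - w^2), which are hook Schur functions in the s_n, satisfy
h_(n,m)' = - d_m r_n. Applying z d/dz to the quadratic relation shows that
(1 - 2n) r_n = s_n + g_n' for some g_n in A, hence
(2n-1) h_(n,m) = zeta_(n,m) + d_m g_n: up to nonzero factors the closed 1-forms
with coefficients h_(n,m) and zeta_(n,m) differ by exact forms. Consequently a
minor of (zeta_(n,m)) is proportional, modulo the images of the flows, to the
corresponding minor of (h_(n,m)). By the Giambelli and Jacobi-Trudi formulas the
latter span the polynomials in the s_n. So the generators of ev1 and of ev2 span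
the same subspace of A modulo the images of the flows, and the graded Nakayama
lemma turns this into the equivalence of the two surjectivity statements.
*)

Set Implicit Arguments.
Unset Strict Implicit.
Unset Printing Implicit Defensive.

Import Order.TTheory GRing.Theory Num.Theory.
Local Open Scope ring_scope.

(** * Formal power series *)

(** The recursion for S_n and the definition of zeta_(ij) both ask for antiderivatives whose
    existence is not evident. Nothing is integrated here. The quadratic relation is a first integral
    of the recursion, normalized by s_0 = 1, and can be solved coefficient by coefficient;
    [kdv_zeta] is an explicit antiderivative. As ' is injective on elements without constant term,
    the choice made in [antider] must return these. The flows of s are also identified without
    integration: a candidate is compared with the true value through the linearized quadratic
    relation, which has only the zero solution. Hooks enter because zeta_(n,m) is in general not a
    polynomial in the s_n, whereas h_(n,m) is; passing from one to the other costs exact 1-forms,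
    and the product of an exact form with closed forms is exact, so its coefficients are sums of
    images of flows. *)

Definition fps (K : Type) : Type := nat -> K.

Section FpsRing.
Variable K : comNzRingType.
Implicit Types f g h : fps K.

HB.instance Definition _ := gen_eqMixin (fps K).
HB.instance Definition _ := gen_choiceMixin (fps K).

Definition fps_add f g : fps K := fun n => f n + g n.
Definition fps_opp f : fps K := fun n => - f n.
Definition fps_zero : fps K := fun=> 0.
Definition fps_one : fps K := fun n => (n == 0)%:R.
Definition fps_mul f g : fps K := fun n => \sum_(i < n.+1) f i * g (n - i)%N.

Lemma fps_addA : associative fps_add.
Proof. by move=> f g h; apply/funext => n; exact: addrA. Qed.
Lemma fps_addC : commutative fps_add.
Proof. by move=> f g; apply/funext => n; exact: addrC. Qed.
Lemma fps_add0 : left_id fps_zero fps_add.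
Proof. by move=> f; apply/funext => n; exact: add0r. Qed.
Lemma fps_addN : left_inverse fps_zero fps_opp fps_add.
Proof. by move=> f; apply/funext => n; exact: addNr. Qed.

HB.instance Definition _ :=
  GRing.isZmodule.Build (fps K) fps_addA fps_addC fps_add0 fps_addN.

Definition fps_trunc N f : {poly K} := \poly_(i < N) f i.

(** Coefficients below N see only the truncations, so the laws of the Cauchy product are inherited
    from polynomials. *)
Lemma fps_mul_trunc N n f g : (n < N)%N ->
  fps_mul f g n = (fps_trunc N f * fps_trunc N g)`_n.
Proof.
move=> nN; rewrite coefM; apply: eq_bigr => i _.
have iN : (i < N)%N by apply: leq_ltn_trans nN; rewrite -ltnS.
by rewrite !coef_poly iN (leq_ltn_trans (leq_subr _ _) nN).
Qed.

Lemma fps_mulA : associative fps_mul.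
Proof.
move=> f g h; apply/funext => n.
transitivity ((fps_trunc n.+1 f * (fps_trunc n.+1 g * fps_trunc n.+1 h))`_n).
  rewrite coefM; apply: eq_bigr => i _; rewrite coef_poly ltn_ord.
  by rewrite -fps_mul_trunc // ltnS leq_subr.
rewrite mulrA coefM; apply: eq_bigr => i _.
by rewrite coef_poly ltnS leq_subr -fps_mul_trunc.
Qed.

Lemma fps_mulC : commutative fps_mul.
Proof.
by move=> f g; apply/funext => n; rewrite !(@fps_mul_trunc n.+1) // mulrC.
Qed.

Lemma fps_mul1 : left_id fps_one fps_mul.
Proof.
move=> f; apply/funext => n; rewrite /fps_mul big_ord_recl /= mul1r subn0.
by rewrite big1 ?addr0 // => i _; rewrite mul0r.
Qed.

Lemma fps_mulDl : left_distributive fps_mul fps_add.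
Proof.
move=> f g h; apply/funext => n; rewrite /fps_mul /fps_add -big_split /=.
by apply: eq_bigr => i _; rewrite mulrDl.
Qed.

Lemma fps_one_neq0 : fps_one != 0.
Proof. by apply/eqP => /(congr1 (fun f : fps K => f 0%N)) /eqP; rewrite oner_eq0. Qed.

HB.instance Definition _ := GRing.Zmodule_isComNzRing.Build (fps K)
  fps_mulA fps_mulC fps_mul1 fps_mulDl fps_one_neq0.

Lemma fpsDE f g n : (f + g) n = f n + g n. Proof. by []. Qed.
Lemma fpsNE f n : (- f) n = - f n. Proof. by []. Qed.
Lemma fpsBE f g n : (f - g) n = f n - g n. Proof. by []. Qed.
Lemma fps1E n : (1 : fps K) n = (n == 0)%:R. Proof. by []. Qed.
Lemma fpsME f g n : (f * g) n = \sum_(i < n.+1) f i * g (n - i)%N. Proof. by []. Qed.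
Lemma fpsMnE f k n : (f *+ k) n = f n *+ k.
Proof. by elim: k => [|k IH]; rewrite ?mulr0n // !mulrS fpsDE IH. Qed.
Lemma fpsM0 f g : (f * g) 0%N = f 0%N * g 0%N.
Proof. by rewrite fpsME big_ord_recl big_ord0 addr0. Qed.

Definition fpsC (c : K) : fps K := fun n => if n is 0 then c else 0.
Definition fpsX : fps K := fun n => (n == 1)%:R.

Lemma fpsCME c f n : (fpsC c * f) n = c * f n.
Proof.
rewrite fpsME big_ord_recl /= subn0 big1 ?addr0 // => i _; exact: mul0r.
Qed.

Lemma fpsXM0 f : (fpsX * f) 0%N = 0.
Proof. by rewrite fpsM0 mul0r. Qed.

Lemma fpsXMS f n : (fpsX * f) n.+1 = f n.
Proof.
rewrite fpsME big_ord_recl mul0r add0r big_ord_recl mul1r /= subSS subn0.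
by rewrite big1 ?addr0 // => i _; exact: mul0r.
Qed.

(** The solution is the limit of the iterates started at 0: coefficient n no longer changes after
    n+1 steps, being determined by the earlier ones. Serves both for inverses and for the quadratic
    relation. *)
Lemma fps_recursion (F : nat -> fps K -> K) :
  (forall n f g, (forall i, (i < n)%N -> f i = g i) -> F n f = F n g) ->
  exists f : fps K, forall n, f n = F n f.
Proof.
move=> Fext; pose Phi (f : fps K) : fps K := fun n => F n f.
have agree k : forall m n, (n < m)%N -> (n < k)%N ->
    iter m Phi 0 n = iter k Phi 0 n.
  elim: k => [|k IH] [|m] n // nm nk /=.
  by apply: Fext => i ilt; apply: IH; [apply: (leq_trans ilt)|apply: (leq_trans ilt)].
exists (fun n => iter n.+1 Phi 0 n) => n.
by apply: Fext => i ilt; apply: agree.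
Qed.

Lemma fps_inv_exists f : f 0%N = 1 -> exists g, f * g = 1.
Proof.
move=> f0; pose F n (g : fps K) :=
  (n == 0)%:R - \sum_(i < n) f i.+1 * g (n - i.+1)%N.
have [|g gE] := @fps_recursion F.
  move=> n g h gh; congr (_ - _); apply: eq_bigr => i _; rewrite gh //.
  by rewrite ltn_subrL /= (leq_ltn_trans _ (ltn_ord i)).
exists g; apply/funext => n; rewrite fpsME big_ord_recl f0 mul1r subn0 gE /F.
by rewrite subrK.
Qed.

Lemma fps_unit_cancel f g : f 0%N = 1 -> f * g = 0 -> g = 0.
Proof.
move=> /fps_inv_exists [h fh] fg; rewrite -[g]mul1r -fh.
by rewrite mulrAC fg mul0r.
Qed.

End FpsRing.

(** * Derivations of rings and of power series *)

Definition derivation (K : nzRingType) (d : K -> K) : Prop :=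
  {morph d : x y / x + y} /\ forall x y, d (x * y) = d x * y + x * d y.

Section Derivation.
Variables (K : comNzRingType) (d : K -> K) (dP : derivation d).

Lemma derD x y : d (x + y) = d x + d y. Proof. exact: dP.1. Qed.
Lemma derM x y : d (x * y) = d x * y + x * d y. Proof. exact: dP.2. Qed.
Lemma der0 : d 0 = 0.
Proof. by apply: (addrI (d 0)); rewrite -derD !addr0. Qed.
Lemma der1 : d 1 = 0.
Proof. by apply: (addrI (d 1)); rewrite addr0 -{3}[1]mulr1 derM mulr1 mul1r. Qed.
Lemma derN x : d (- x) = - d x.
Proof. by apply: (addrI (d x)); rewrite -derD !subrr der0. Qed.
Lemma derB x y : d (x - y) = d x - d y. Proof. by rewrite derD derN. Qed.
Lemma derMn x n : d (x *+ n) = d x *+ n.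
Proof. by elim: n => [|n IH]; rewrite ?der0 // !mulrS derD IH. Qed.
Lemma der_nat n : d n%:R = 0. Proof. by rewrite derMn der1 mul0rn. Qed.
Lemma der_sum I (r : seq I) (P : pred I) F :
  d (\sum_(i <- r | P i) F i) = \sum_(i <- r | P i) d (F i).
Proof. exact: (big_morph d derD der0). Qed.

Definition fps_map (f : fps K) : fps K := fun n => d (f n).

Lemma fps_map_derivation : derivation fps_map.
Proof.
split=> f g; apply/funext => n; first exact: derD.
rewrite /fps_map fpsDE !fpsME der_sum -big_split /=.
by apply: eq_bigr => i _; rewrite derM.
Qed.

Lemma fps_map_X : fps_map (fpsX K) = 0.
Proof. by apply/funext => n; rewrite /fps_map /fpsX der_nat. Qed.

Lemma fps_map_C c : fps_map (fpsC c) = fpsC (d c).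
Proof. by apply/funext => -[|n] //=; rewrite /fps_map /= der0. Qed.
End Derivation.

(** The operator x d/dx; the series variable is x = z^(-2), so this is -1/2 z d/dz. *)
Definition fps_theta (K : comNzRingType) (f : fps K) : fps K := fun n => f n *+ n.

Lemma fps_theta_derivation (K : comNzRingType) : derivation (@fps_theta K).
Proof.
split=> f g; apply/funext => n; first by rewrite /fps_theta fpsDE mulrnDl.
rewrite /fps_theta fpsDE !fpsME -sumrMnl -big_split /=.
apply: eq_bigr => i _; rewrite mulrnAl mulrnAr -mulrnDr subnKC //.
by rewrite -ltnS.
Qed.

Lemma fps_theta_X (K : comNzRingType) : fps_theta (fpsX K) = fpsX K.
Proof. by apply/funext => -[|[|n]] //; rewrite /fps_theta /fpsX mul0rn. Qed.

Lemma fps_theta_map (K : comNzRingType) (d : K -> K) (dP : derivation d) f :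
  fps_theta (fps_map d f) = fps_map d (fps_theta f).
Proof. by apply/funext => n; rewrite /fps_theta /fps_map derMn. Qed.

(** * Differential polynomials *)

(* Conversion checks that unfold {malg C[M]} do not terminate in practice; hence
   an interface with the facts on differential polynomials that matter. *)
Record dpoly (C : numFieldType) := DPoly {
  dp_alg :> comAlgType C;
  dp_mon : {cmonom nat} -> dp_alg;
  dp_coef : {cmonom nat} -> dp_alg -> C;
  dp_deriv : (nat -> dp_alg) -> dp_alg -> dp_alg;
  dp_mon1 : dp_mon (onecm _) = 1;
  dp_monM : forall m1 m2, dp_mon (mulcm m1 m2) = dp_mon m1 * dp_mon m2;
  dp_coefD : forall m a b, dp_coef m (a + b) = dp_coef m a + dp_coef m b;
  dp_coefZ : forall m c a, dp_coef m (c *: a) = c * dp_coef m a;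
  dp_coef_mon : forall m k, dp_coef m (dp_mon k) = (k == m)%:R;
  dp_coef1M : forall a b,
    dp_coef (onecm _) (a * b) = dp_coef (onecm _) a * dp_coef (onecm _) b;
  dp_ext : forall a b, (forall m, dp_coef m a = dp_coef m b) -> a = b;
  dp_ind : forall P : dp_alg -> Prop, (forall c m, P (c *: dp_mon m)) ->
    (forall a b, P a -> P b -> P (a + b)) -> forall a, P a;
  dp_derivD : forall f a b, dp_deriv f (a + b) = dp_deriv f a + dp_deriv f b;
  dp_deriv_mon : forall f c m, dp_deriv f (c *: dp_mon m) =
    c *: \sum_(i <- finsupp (cmonom_val m)) ((cmonom_val m i)%:R *:
           (dp_mon (divcm m (ucm i)) * f i)) }.

Section DerivBy.
Variables (C : numFieldType) (A : dpoly C).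
Implicit Types (f : nat -> A) (a b g : A) (m : {cmonom nat}).

Local Notation mon := (@dp_mon C A).
Local Notation coef := (@dp_coef C A).
Local Notation der := (@dp_deriv C A).

Definition dp_var (k : nat) : A := mon (ucm k).
Local Notation u_ := dp_var.

Definition deriv_mon f m : A :=
  \sum_(i <- finsupp (cmonom_val m)) ((cmonom_val m i)%:R *:
     (mon (divcm m (ucm i)) * f i)).

Definition dp_prime : A -> A := der (fun k => u_ k.+1).
Definition dp_const : A -> C := coef (onecm _).

Lemma dp_derivU f m : der f (mon m) = deriv_mon f m.
Proof. by rewrite -[mon m]scale1r dp_deriv_mon scale1r. Qed.

Lemma dp_deriv0 f : der f 0 = 0.
Proof. by apply: (addrI (der f 0)); rewrite -dp_derivD !addr0. Qed.

Lemma dp_derivZ f c a : der f (c *: a) = c *: der f a.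
Proof.
elim/dp_ind: a => [e m|a b IHa IHb]; first by rewrite scalerA !dp_deriv_mon scalerA.
by rewrite scalerDr !dp_derivD IHa IHb scalerDr.
Qed.

Lemma deriv_monEw f m (d : {fset nat}) : (finsupp (cmonom_val m) `<=` d)%fset ->
  deriv_mon f m = \sum_(i <- d) (cmonom_val m i)%:R *: (mon (divcm m (ucm i)) * f i).
Proof.
move=> le; rewrite /deriv_mon (big_fset_incl _ le) // => i _.
by rewrite -cmE_eq0 => /eqP ->; rewrite scale0r.
Qed.

Lemma divcm_mulcm m1 m2 i : (0 < cmonom_val m1 i)%N ->
  divcm (mulcm m1 m2) (ucm i) = mulcm (divcm m1 (ucm i)) m2.
Proof.
move=> gt0; apply/eqP/cmP => j; rewrite divcmE !mulcmE divcmE ucmE.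
by case: eqP => [<-|_]; lia.
Qed.

Lemma deriv_monM f m1 m2 : deriv_mon f (mulcm m1 m2) =
  deriv_mon f m1 * mon m2 + mon m1 * deriv_mon f m2.
Proof.
pose d := (finsupp (cmonom_val m1) `|` finsupp (cmonom_val m2))%fset.
rewrite (@deriv_monEw _ _ d); last by have /= -> := mdomD m1 m2.
rewrite (@deriv_monEw _ m1 d) ?fsubsetUl // (@deriv_monEw _ m2 d) ?fsubsetUr //.
rewrite mulr_suml mulr_sumr -big_split /=; apply: eq_bigr => i _.
rewrite mulcmE natrD scalerDl; congr (_ + _).
  have [->|gt0] := posnP (cmonom_val m1 i); first by rewrite !scale0r mul0r.
  by rewrite divcm_mulcm // dp_monM -scalerAl mulrAC.
have [->|gt0] := posnP (cmonom_val m2 i); first by rewrite !scale0r mulr0.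
by rewrite mulcmC divcm_mulcm // dp_monM -scalerAr mulrA [X in X * f i]mulrC.
Qed.

Lemma dp_derivM f a b : der f (a * b) = der f a * b + a * der f b.
Proof.
elim/dp_ind: a => [c m|a a' IHa IHa']; last first.
  by rewrite mulrDl !dp_derivD IHa IHa' !mulrDl addrACA.
elim/dp_ind: b => [e k|b b' IHb IHb']; last first.
  by rewrite mulrDr !dp_derivD IHb IHb' !mulrDr addrACA.
rewrite -!scalerAl -!scalerAr -dp_monM !dp_derivZ !dp_derivU deriv_monM.
by rewrite !scalerDr -!scalerAl -!scalerAr !scalerA [e * c]mulrC.
Qed.

Lemma dp_deriv_derivation f : derivation (der f).
Proof. by split; [exact: dp_derivD|exact: dp_derivM]. Qed.

Lemma dp_deriv_uvar f k : der f (u_ k) = f k.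
Proof.
rewrite dp_derivU /deriv_mon; have /= -> := mdomU k.
rewrite big_seq_fset1 ucmE eqxx scale1r.
have -> : divcm (ucm k) (ucm k) = onecm _.
  by apply/eqP/cmP => j; rewrite divcmE onecmE subnn.
by rewrite dp_mon1 mul1r.
Qed.

Lemma cmonom_split m i : (0 < cmonom_val m i)%N -> m = mulcm (ucm i) (divcm m (ucm i)).
Proof.
by move=> gt0; apply/eqP/cmP => j; rewrite mulcmE divcmE ucmE; case: eqP => [<-|_]; lia.
Qed.

Lemma cmonom_neq1 m : m != onecm _ -> exists i, (0 < cmonom_val m i)%N.
Proof.
move=> m1; apply: contrapT => /forallNP h; case/negP: m1; apply/cmP => i.
by rewrite onecmE; have := h i; case: (cmonom_val m i).
Qed.

Lemma cmonom_ind (P : {cmonom nat} -> Prop) : P (onecm _) ->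
  (forall i m, P m -> P (mulcm (ucm i) m)) -> forall m, P m.
Proof.
move=> P1 PS m; have [n] := ubnP (mdeg m); elim: n m => // n IH m.
have [->//|/cmonom_neq1 [i gt0]] := eqVneq m (onecm _).
rewrite (cmonom_split gt0) => le; apply/PS/IH.
by move: le; have /= -> := mdegM (ucm i) (divcm m (ucm i)); rewrite mdegU.
Qed.

(** The workhorse for operator identities: commutators and multiples of derivations are derivations,
    so comparing them on the generators suffices. *)
Lemma derivation_ext (d e : A -> A) : derivation d -> derivation e ->
  (forall c a, d (c *: a) = c *: d a) -> (forall c a, e (c *: a) = c *: e a) ->
  (forall k, d (u_ k) = e (u_ k)) -> d =1 e.
Proof.
move=> dP eP dZ eZ du; elim/dp_ind => [c m|a b IHa IHb]; last first.
  by rewrite (derD dP) (derD eP) IHa IHb.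
rewrite dZ eZ; congr (_ *: _).
elim/cmonom_ind: m => [|i m IH]; first by rewrite dp_mon1 (der1 dP) (der1 eP).
by rewrite dp_monM (derM dP) (derM eP) IH du.
Qed.

Lemma dp_deriv_ext f1 f2 : f1 =1 f2 -> der f1 =1 der f2.
Proof.
move=> f12; apply: derivation_ext; try exact: dp_deriv_derivation; try exact: dp_derivZ.
by move=> k; rewrite !dp_deriv_uvar.
Qed.

Lemma dp_deriv_scale c f a : der (fun k => c *: f k) a = c *: der f a.
Proof.
move: a; apply: derivation_ext; [exact: dp_deriv_derivation| |exact: dp_derivZ| |].
- split=> [a b|a b]; first by rewrite dp_derivD scalerDr.
  by rewrite dp_derivM scalerDr scalerAl scalerAr.
- by move=> e a; rewrite dp_derivZ !scalerA mulrC.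
- by move=> k; rewrite !dp_deriv_uvar.
Qed.

(** The cross terms of the Leibniz rule are symmetric in the two derivations, so the commutator is
    itself a derivation. *)
Lemma dp_deriv_comm f1 f2 :
  (forall k, der f1 (f2 k) = der f2 (f1 k)) ->
  forall a, der f1 (der f2 a) = der f2 (der f1 a).
Proof.
move=> comm; elim/dp_ind => [c m|a b IHa IHb]; last by rewrite !dp_derivD IHa IHb.
rewrite !dp_derivZ; congr (_ *: _).
elim/cmonom_ind: m => [|i m IH].
  by rewrite dp_mon1 !(der1 (dp_deriv_derivation _)) !dp_deriv0.
rewrite dp_monM !dp_derivM !dp_derivD !dp_derivM IH !dp_deriv_uvar comm.
rewrite !addrA; congr (_ + _); rewrite -!addrA; congr (_ + _); exact: addrC.
Qed.

Lemma dp_coef0 m : coef m 0 = 0.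
Proof. by apply: (addrI (coef m 0)); rewrite -dp_coefD !addr0. Qed.
Lemma dp_constD : {morph dp_const : a b / a + b}.
Proof. by move=> a b; rewrite /dp_const dp_coefD. Qed.
Lemma dp_const0 : dp_const 0 = 0.
Proof. exact: dp_coef0. Qed.
Lemma dp_constZ c a : dp_const (c *: a) = c * dp_const a.
Proof. exact: dp_coefZ. Qed.
Lemma dp_constN a : dp_const (- a) = - dp_const a.
Proof. by rewrite -scaleN1r dp_constZ mulN1r. Qed.
Lemma dp_constB a b : dp_const (a - b) = dp_const a - dp_const b.
Proof. by rewrite dp_constD dp_constN. Qed.
Lemma dp_constM a b : dp_const (a * b) = dp_const a * dp_const b.
Proof. exact: dp_coef1M. Qed.
Lemma dp_const_sum I (r : seq I) (P : pred I) (F : I -> A) :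
  dp_const (\sum_(i <- r | P i) F i) = \sum_(i <- r | P i) dp_const (F i).
Proof. exact: (big_morph _ dp_constD dp_const0). Qed.
Lemma dp_const_uvar k : dp_const (u_ k) = 0.
Proof.
rewrite /dp_const dp_coef_mon; case: eqP => // /(congr1 (fun m => cmonom_val m k)).
by rewrite onecmE ucmE eqxx.
Qed.

Lemma dp_const_deriv f a : (forall k, dp_const (f k) = 0) ->
  dp_const (der f a) = 0.
Proof.
move=> f0; elim/dp_ind: a => [c m|a b IHa IHb]; last first.
  by rewrite dp_derivD dp_constD IHa IHb addr0.
rewrite dp_derivZ dp_derivU dp_constZ dp_const_sum big1 ?mulr0 // => i _.
by rewrite dp_constZ dp_constM f0 !mulr0.
Qed.

Definition weight_by (w : nat -> nat) m : nat :=
  (\sum_(i <- finsupp (cmonom_val m)) cmonom_val m i * w i)%N.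

Lemma dp_deriv_diag_mon (w : nat -> nat) m :
  der (fun i => (w i)%:R *: u_ i) (mon m) = (weight_by w m)%:R *: mon m.
Proof.
rewrite dp_derivU /weight_by natr_sum scaler_suml; apply: eq_big_seq => i /=.
rewrite -cmE_neq0 -lt0n => gt0; rewrite -scalerAr scalerA -natrM.
by rewrite mulrC -dp_monM -cmonom_split.
Qed.

(** Scaling each variable by a weight acts diagonally on monomials. The weights i+2 yield the
    grading; the indicator of one variable reads off its exponent. *)
Lemma dp_deriv_diag (w : nat -> nat) a m :
  coef m (der (fun i => (w i)%:R *: u_ i) a) = (weight_by w m)%:R * coef m a.
Proof.
elim/dp_ind: a => [c k|a b IHa IHb]; last by rewrite dp_derivD !dp_coefD IHa IHb mulrDr.
rewrite dp_derivZ dp_deriv_diag_mon !dp_coefZ dp_coef_mon.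
by case: eqP => [->|_]; rewrite ?mulr0 // !mulr1 mulrC.
Qed.

Lemma weight_by_gt0 (w : nat -> nat) m i :
  (0 < cmonom_val m i)%N -> (0 < w i)%N -> (0 < weight_by w m)%N.
Proof.
move=> mi wi; have imem : i \in finsupp (cmonom_val m) by rewrite -cmE_neq0 -lt0n.
by rewrite /weight_by (big_fsetD1 i) //= ltn_addr // muln_gt0 mi.
Qed.

Lemma partials_eq0_const a :
  (forall k, der (fun i => (i == k)%:R) a = 0) -> a = (dp_const a)%:A.
Proof.
move=> pa; apply: dp_ext => m; rewrite dp_coefZ -dp_mon1 dp_coef_mon.
have [<-|] := eqVneq (onecm _) m; first by rewrite mulr1.
rewrite eq_sym => m1; rewrite mulr0; have [k mk] := cmonom_neq1 m1.
pose w (i : nat) : nat := (i == k).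
(* Multiplying the k-th partial derivative by u_k gives the diagonal derivation with indicator
   weights, which scales the coefficient at m by the positive exponent of u_k in m. *)
have hw : der (fun i => (w i)%:R *: u_ i) a = 0.
  transitivity (u_ k * der (fun i => (i == k)%:R) a); last by rewrite pa mulr0.
  move: (a); apply: derivation_ext; [exact: dp_deriv_derivation| |exact: dp_derivZ| |].
  - split=> [x y|x y]; first by rewrite dp_derivD mulrDr.
    by rewrite dp_derivM mulrDr mulrA mulrCA.
  - by move=> e x; rewrite dp_derivZ -scalerAr.
  - move=> j; rewrite !dp_deriv_uvar /w; case: eqP => [->|_]; last by rewrite scale0r mulr0.
    by rewrite scale1r mulr1.
have := dp_deriv_diag w a m; rewrite hw dp_coef0 => /esym/eqP.
rewrite mulf_eq0 pnatr_eq0 => /orP[|/eqP//].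
by have := @weight_by_gt0 w m k mk; rewrite /w eqxx => /(_ isT); case: weight_by.
Qed.

Lemma partial_eventually0 a :
  exists K, forall k, (K <= k)%N -> der (fun i => (i == k)%:R) a = 0.
Proof.
elim/dp_ind: a => [c m|a b [K1 h1] [K2 h2]]; last first.
  exists (maxn K1 K2) => k; rewrite geq_max => /andP[/h1 e1 /h2 e2].
  by rewrite dp_derivD e1 e2 addr0.
exists (\max_(i <- finsupp (cmonom_val m)) i).+1%N => k lek.
rewrite dp_derivZ dp_derivU /deriv_mon big1_seq ?scaler0 // => i /andP[_ im].
case: eqP => [ik|_]; last by rewrite mulr0 scaler0.
suff : (i <= \max_(i <- finsupp (cmonom_val m)) i)%N by rewrite ik leqNgt lek.
exact: (@leq_bigmax_seq _ (enum_fset (finsupp (cmonom_val m))) xpredT id i im isT).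
Qed.

Lemma dp_prime_derivation : derivation dp_prime.
Proof. exact: dp_deriv_derivation. Qed.

Lemma dp_primeZ c a : dp_prime (c *: a) = c *: dp_prime a.
Proof. exact: dp_derivZ. Qed.

Lemma dp_const_prime a : dp_const (dp_prime a) = 0.
Proof. by apply: dp_const_deriv => k; exact: dp_const_uvar. Qed.

(* [d/du_(k+1), '] = d/du_k, so the partial derivatives of an element of the
   kernel of ' vanish by descending induction. *)
Lemma dp_prime_eq0 a : dp_prime a = 0 -> dp_const a = 0 -> a = 0.
Proof.
move=> pa ca; suff pk k : der (fun i => (i == k)%:R) a = 0.
  by rewrite (partials_eq0_const pk) ca scale0r.
have comm j b : der (fun i => (i == j.+1)%:R) (dp_prime b) =
    dp_prime (der (fun i => (i == j.+1)%:R) b) + der (fun i => (i == j)%:R) b.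
  rewrite -[LHS](subrK (dp_prime (der (fun i => (i == j.+1)%:R) b))) addrC.
  congr (_ + _); move: b; apply: derivation_ext.
  - split=> [x y|x y]; first by rewrite !(derD dp_prime_derivation, dp_derivD) opprD addrACA.
    rewrite !(derM dp_prime_derivation, dp_derivM, derD dp_prime_derivation, dp_derivD).
    by rewrite /dp_prime; ring.
  - exact: dp_deriv_derivation.
  - by move=> c x; rewrite !(dp_derivZ, dp_primeZ) scalerBr.
  - exact: dp_derivZ.
  - move=> i; rewrite /dp_prime !dp_deriv_uvar eqSS.
    by rewrite (der_nat (dp_deriv_derivation _)) subr0.
have [K hK] := partial_eventually0 a.
have down n : (n <= K)%N -> der (fun i => (i == (K - n)%N)%:R) a = 0.
  elim: n => [|n IH] nK; first by rewrite subn0 hK.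
  have := comm (K - n.+1)%N a; rewrite -subSn // subSS.
  rewrite pa dp_deriv0 IH; last exact: ltnW.
  by rewrite (der0 dp_prime_derivation) add0r.
have [/hK//|/ltnW kK] := leqP K k.
by have := down (K - k)%N (leq_subr _ _); rewrite subKn.
Qed.

Lemma dp_prime_inj a b : dp_const a = dp_const b -> dp_prime a = dp_prime b -> a = b.
Proof.
move=> cab pab; apply/eqP; rewrite -subr_eq0; apply/eqP/dp_prime_eq0.
  by rewrite (derB dp_prime_derivation) pab subrr.
by rewrite dp_constB cab subrr.
Qed.

End DerivBy.

(** * The resolvent series and the flows *)

Section FpsLow.
Variable K : comNzRingType.
Implicit Types f g : fps K.

Lemma fpsM_eq n f f' g g' : (forall i, (i <= n)%N -> f i = f' i) ->
  (forall i, (i <= n)%N -> g i = g' i) -> (f * g) n = (f' * g') n.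
Proof.
move=> ff gg; rewrite !fpsME; apply: eq_bigr => i _.
by rewrite ff ?gg ?leq_subr // -ltnS.
Qed.

Lemma fpsM_low n f g : (forall i, (i <= n)%N -> f i = 0) -> (f * g) n = 0.
Proof.
by move=> f0; rewrite fpsME big1 // => i _; rewrite f0 ?mul0r // -ltnS.
Qed.

Lemma fpsM_lead n f g : (forall i, (i < n)%N -> g i = 0) -> (f * g) n = f 0%N * g n.
Proof.
move=> g0; rewrite fpsME big_ord_recl subn0 big1 ?addr0 // => i _.
by rewrite g0 ?mulr0 // lift0 subnSK // leq_subr.
Qed.
End FpsLow.

(** As n'_b = n_b + b - sg(b), the sum of squares grows by 2 sum n_b (b - sg(b)) + sum (b -
    sg(b))^2. The first sum is nonnegative by the last hypothesis, the second positive because sg is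
    not the identity. *)
Lemma sumn_sqr_shift N (n n' : 'I_N -> nat) (sg : 'S_N) : sg != 1%g ->
  (forall b : 'I_N, n' b + sg b = n b + b)%N ->
  (\sum_(b < N) sg b * n b <= \sum_(b < N) b * n b)%N ->
  (\sum_b n b ^ 2 < \sum_b n' b ^ 2)%N.
Proof.
move=> sg1 nn' maxn.
have sq : (\sum_(b < N) (b * sg b).*2 < \sum_(b < N) (b ^ 2 + sg b ^ 2))%N.
  have [b bsg] : exists b, sg b != b.
    apply: contrapT => /forallNP h; case/eqP: sg1; apply/permP => b; rewrite perm1.
    by apply/eqP/negPn/negP; exact: h.
  rewrite (bigD1 b) //= [X in (_ < X)%N](bigD1 b) //= -addSn leq_add //.
    by rewrite -mul2n (ltn_leqif (nat_Cauchy _ _)) eq_sym.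
  by apply: leq_sum => i _; rewrite -mul2n; exact: (nat_Cauchy _ _).1.
have e : (\sum_b n' b ^ 2 + (\sum_(b < N) sg b * n b).*2 + \sum_(b < N) (b * sg b).*2 =
          \sum_b n b ^ 2 + (\sum_(b < N) b * n b).*2 + \sum_(b < N) (b ^ 2 + sg b ^ 2))%N.
  rewrite -!mul2n !big_distrr /= -!big_split /=; apply: eq_bigr => b _.
  by have := nn' b; rewrite -!mulnn; nia.
lia.
Qed.

Section KdVSeries.
Variables (C : numFieldType) (A : dpoly C).
Implicit Types (a : A) (f : fps A).
Local Notation p := (@dp_prime C A).
Local Notation P := (fps_map (@dp_prime C A)).
Local Notation u_ := (@dp_var C A).
Local Notation uu := (fpsC (u_ 0)).
Local Notation X := (fpsX A).

Let pD := @dp_prime_derivation C A.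
Let PD := fps_map_derivation pD.

Lemma dp_mulrn_inj n : injective (fun a : A => a *+ n.+1).
Proof.
move=> a b /eqP; rewrite -subr_eq0 -mulrnBl -scaler_nat => /eqP h.
apply/eqP; rewrite -subr_eq0; apply/eqP.
by rewrite -[LHS]scale1r -(@mulVf C n.+1%:R) ?pnatr_eq0 // -scalerA h scaler0.
Qed.

Definition kdv_rhs f : fps A := (f * P (P f)) *+ 2 - P f * P f - (uu * (f * f)) *+ 4.

Definition kdv_quadratic f : Prop :=
  f 0%N = 1 /\ (f * f - 1) *+ 4 = X * kdv_rhs f.

Lemma kdv_rhs_eq n f g : (forall i, (i <= n)%N -> f i = g i) ->
  kdv_rhs f n = kdv_rhs g n.
Proof.
move=> fg; have fg' i : (i <= n)%N -> P f i = P g i by move=> /fg; rewrite /fps_map => ->.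
have fg2 i : (i <= n)%N -> P (P f) i = P (P g) i by move=> /fg'; rewrite /fps_map => ->.
rewrite /kdv_rhs !fpsBE !fpsMnE !fpsCME; congr (_ *+ _ - _ - _ * _ *+ _);
  exact: fpsM_eq.
Qed.

(** Coefficient n of 4 s^2 contains 8 s_n, from s_0 s_n + s_n s_0; the factor X on the other side
    lets only earlier coefficients in. *)
Lemma kdv_quadratic_exists : exists s : fps A, kdv_quadratic s.
Proof.
pose F n f : A := if n is k.+1 then (8%:R : C)^-1 *:
    (kdv_rhs f k - (\sum_(i < k) f i.+1 * f (k - i)%N) *+ 4) else 1.
have [|s sE] := @fps_recursion _ F.
  case=> [//|k] f g fg; rewrite /F (@kdv_rhs_eq k f g) //.
  congr (_ *: (_ - _ *+ _)); apply: eq_bigr => i _.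
  by rewrite !fg // ltnS ?leq_subr // ltnW.
exists s; split; first exact: sE.
apply/funext => -[|k]; rewrite fpsMnE fpsBE fps1E.
  by rewrite fpsXM0 fpsM0 sE mulr1 subrr mul0rn.
rewrite fpsXMS subr0 fpsME big_ord_recl big_ord_recr /= subn0 subnn.
rewrite (sE 0%N) mul1r mulr1.
under eq_bigr do rewrite /bump /= add1n subSS.
set Q := \sum_(i < k) _; rewrite sE /F -/Q.
set c := _ *: _.
have -> : (c + (Q + c)) *+ 4 = c *+ 8 + Q *+ 4.
  by rewrite addrCA mulrnDl addrC -mulr2n -mulrnA.
rewrite /c -scaler_nat scalerA mulfV ?pnatr_eq0 // scale1r.
by rewrite subrK.
Qed.

Variable s : fps A.
Hypothesis sQ : kdv_quadratic s.

Lemma kdv_s0 : s 0%N = 1. Proof. exact: sQ.1. Qed.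
Local Notation s0 := kdv_s0.

Lemma fps_mulrn_inj n : injective (fun f => f *+ n.+1).
Proof.
move=> f g /= fg; apply/funext => i; apply: (@dp_mulrn_inj n).
by have := congr1 (fun h : fps A => h i) fg; rewrite !fpsMnE.
Qed.

(* Differentiating the quadratic relation gives 2 s times this linear one. *)
Lemma kdv_linear_series :
  P s *+ 4 = X * (P (P (P s)) - (uu * P s) *+ 4 - (fpsC (p (u_ 0)) * s) *+ 2).
Proof.
have h := congr1 (fps_map (@dp_prime C A)) sQ.2; move: h.
rewrite /kdv_rhs (derMn PD) (derB PD) (der1 PD) !(derM PD) fps_map_X // mul0r add0r.
rewrite !(derB PD, derMn PD, derM PD) fps_map_C // => h.
apply/eqP; rewrite -subr_eq0; apply/eqP; apply: (fps_unit_cancel s0).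
apply: (@fps_mulrn_inj 1); rewrite mul0rn.
move/eqP: h; rewrite -subr_eq0 => /eqP h; rewrite -[RHS]h; ring.
Qed.

Lemma kdv_linear n : p (s n.+1) *+ 4 =
  p (p (p (s n))) - (u_ 0 * p (s n)) *+ 4 - (p (u_ 0) * s n) *+ 2.
Proof.
have /(congr1 (fun f : fps A => f n.+1)) := kdv_linear_series.
by rewrite fpsMnE fpsXMS !fpsBE !fpsMnE !fpsCME.
Qed.

Lemma dp_constMn a n : dp_const (a *+ n) = dp_const a *+ n.
Proof. by rewrite -scaler_nat dp_constZ mulr_natl. Qed.

(** Taking constant terms is multiplicative and kills u and all derivatives, hence the right-hand
    side of the quadratic relation; by induction the left-hand side reduces to a multiple of s_n. *)
Lemma kdv_const n : (0 < n)%N -> dp_const (s n) = 0.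
Proof.
have [N] := ubnP n; elim: N n => // N IH [//|n] nN _.
have /(congr1 (fun f : fps A => dp_const (f n.+1))) := sQ.2.
have -> : dp_const ((X * kdv_rhs s) n.+1) = 0.
  rewrite fpsXMS /kdv_rhs !fpsBE !fpsMnE !fpsCME !dp_constB !dp_constMn dp_constM.
  rewrite dp_const_uvar mul0r mul0rn subr0 !fpsME !dp_const_sum !big1 ?mul0rn ?subr0 //.
  - by move=> i _; rewrite dp_constM dp_const_prime mul0r.
  - by move=> i _; rewrite dp_constM dp_const_prime mulr0.
rewrite fpsMnE fpsBE fps1E subr0 dp_constMn fpsME big_ord_recl big_ord_recr /=.
rewrite subn0 subnn s0 mul1r mulr1 !dp_constD dp_const_sum big1; last first.
  move=> i _; rewrite /bump /= add1n dp_constM IH ?mul0r //.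
  by have := ltn_ord i; lia.
rewrite add0r -mulr2n -mulrnA => /eqP; rewrite mulrn_eq0 /= => /eqP //.
Qed.

Lemma kdv_s1 : s 1%N *+ 2 = - u_ 0.
Proof.
apply: dp_prime_inj.
  by rewrite dp_constMn kdv_const // dp_constN dp_const_uvar mul0rn oppr0.
apply: (@dp_mulrn_inj 1); rewrite (derMn pD) -mulrnA kdv_linear s0 (der1 pD).
by rewrite !(der0 pD) mulr0 mul0rn mulr1 !sub0r (derN pD) mulNrn oppr0 add0r.
Qed.

(* [kdv_flow m] is the usual flow along t_(2m-1), for which [kdv_flow 1] is ';
   the normalization S_2 = -u/2 makes [dflow (2m-1)] equal to -1/2 of it. *)
Definition kdv_flow (m : nat) : A -> A :=
  dp_deriv (fun k => - (iter k.+1 (@dp_prime C A) (s m) *+ 2)).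
Local Notation D := kdv_flow.

Lemma flow_derivation m : derivation (D m).
Proof. exact: dp_deriv_derivation. Qed.

Lemma flowZ m c a : D m (c *: a) = c *: D m a.
Proof. exact: dp_derivZ. Qed.

Lemma flow_prime m a : D m (p a) = p (D m a).
Proof.
apply: dp_deriv_comm => k; rewrite dp_deriv_uvar -/(dp_prime _).
by rewrite (derN pD) (derMn pD).
Qed.

Lemma flow_u0 m : D m (u_ 0) = - (p (s m) *+ 2).
Proof. by rewrite /D dp_deriv_uvar. Qed.

Lemma flow_const m a : dp_const (D m a) = 0.
Proof.
apply: dp_const_deriv => k.
by rewrite dp_constN dp_constMn iterS dp_const_prime mul0rn oppr0.
Qed.

Lemma flow0 a : D 0 a = 0.
Proof.
transitivity (dp_deriv (fun k => (0 : C) *: u_ k) a); last first.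
  by rewrite dp_deriv_scale scale0r.
apply: dp_deriv_ext => k; rewrite scale0r s0 iterSr (der1 pD).
suff -> : iter k (@dp_prime C A) 0 = 0 by rewrite mul0rn oppr0.
by elim: k => //= k ->; rewrite (der0 pD).
Qed.

Lemma flow1 a : D 1 a = p a.
Proof.
apply: dp_deriv_ext => k.
have iterMn n b : iter n (@dp_prime C A) (b *+ 2) = iter n (@dp_prime C A) b *+ 2.
  by elim: n => //= n ->; rewrite (derMn pD).
rewrite -iterMn kdv_s1.
suff h n : iter n (@dp_prime C A) (- u_ 0) = - u_ n by rewrite h opprK.
by elim: n => //= n ->; rewrite (derN pD) /dp_prime dp_deriv_uvar.
Qed.

(* The linearization of the quadratic relation, which has no nonzero solution. *)
Definition kdv_lin (Z : fps A) : fps A := (s * Z) *+ 8 -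
  X * ((Z * P (P s)) *+ 2 + (P (P Z) * s) *+ 2 - (P Z * P s) *+ 2 - (Z * (uu * s)) *+ 8).

(** If the coefficients of Z before the n-th vanish, coefficient n of [kdv_lin Z] is 8 Z_n, since
    the other terms carry the factor X. *)
Lemma kdv_lin_inj Z : kdv_lin Z = 0 -> Z = 0.
Proof.
move=> LZ; suff h n : forall i, (i < n)%N -> Z i = 0 by apply/funext => n; apply: (h n.+1).
elim: n => // n IH i; rewrite ltnS leq_eqVlt => /orP[/eqP ->|]; last exact: IH.
have /(congr1 (fun f : fps A => f n)) := LZ.
rewrite /kdv_lin fpsBE fpsMnE fpsM_lead // s0 mul1r => /eqP; rewrite subr_eq0 => /eqP h.
apply: (@dp_mulrn_inj 7); rewrite /= mul0rn h {h}; case: n IH => [|n] IH.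
  exact: fpsXM0.
have low1 j : (j <= n)%N -> P Z j = 0.
  by move=> jn; rewrite /fps_map IH ?(der0 pD).
have low2 j : (j <= n)%N -> P (P Z) j = 0.
  by move=> jn; rewrite /fps_map IH ?(der0 pD).
have low0 j : (j <= n)%N -> Z j = 0 by exact: IH.
rewrite fpsXMS !fpsBE fpsDE !fpsMnE !(fpsM_low _ low0) (fpsM_low _ low1) (fpsM_low _ low2).
by rewrite !mul0rn addr0 !subr0.
Qed.

(** The difference of the two sides is tested with the injective map [kdv_lin], whose value on a
    flow of s comes from applying that flow to the quadratic relation. *)
Lemma flow_recursion_series (b : nat) : fps_map (D b) s =
  X * (fps_map (D b.+1) s + s * fpsC (p (s b)) - P s * fpsC (s b)).
Proof.
have DD m := fps_map_derivation (flow_derivation m).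
have Dp m f : fps_map (D m) (P f) = P (fps_map (D m) f).
  by apply/funext => n; rewrite /fps_map flow_prime.
have LX m : kdv_lin (fps_map (D m) s) = X * (fpsC (p (s m)) * (s * s)) *+ 8.
  have h := congr1 (fps_map (D m)) sQ.2; move: h.
  have DX : fps_map (D m) X = 0 by apply: fps_map_X; exact: flow_derivation.
  rewrite /kdv_rhs (derMn (DD m)) (derB (DD m)) (der1 (DD m)) !(derM (DD m)) DX mul0r add0r.
  rewrite !(derB (DD m), derMn (DD m), derM (DD m)) !Dp.
  rewrite fps_map_C; last exact: flow_derivation.
  rewrite flow_u0.
  have -> : fpsC (- ((p (s m)) *+ 2)) = - (fpsC (p (s m)) *+ 2) :> fps A.
    by apply/funext => -[|n] //; rewrite fpsNE fpsMnE //= mul0rn oppr0.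
  move/eqP; rewrite -subr_eq0 => /eqP h; apply/eqP; rewrite -subr_eq0; apply/eqP.
  by rewrite -[RHS]h /kdv_lin; ring.
apply/eqP; rewrite -subr_eq0; apply/eqP/kdv_lin_inj.
move: (LX b) (LX b.+1); set Y := fps_map (D b) s; set Y1 := fps_map (D b.+1) s.
move/eqP; rewrite -subr_eq0 => /eqP h0; move/eqP; rewrite -subr_eq0 => /eqP h1.
have [hs hb] := (kdv_linear_series, kdv_linear b).
move/eqP: hs; rewrite -subr_eq0 => /eqP hs.
have {hb} : fpsC (p (s b.+1)) *+ 4 - (fpsC (p (p (p (s b)))) - (uu * fpsC (p (s b))) *+ 4
   - (fpsC (p (u_ 0)) * fpsC (s b)) *+ 2) = 0.
  apply/funext => -[|n]; rewrite !(fpsBE, fpsMnE, fpsCME) /=; first by rewrite hb subrr.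
  by rewrite !mulr0 !mul0rn !subr0.
set R := fpsC (s b); set R1 := fpsC (p (s b)); set R3 := fpsC (p (p (p _))).
set Q1 := fpsC (p (s b.+1)) => hb.
have RP : P R = R1 by rewrite /R fps_map_C.
have R1P : P R1 = fpsC (p (p (s b))) by rewrite /R1 fps_map_C.
have R2P : P (fpsC (p (p (s b)))) = R3 by rewrite fps_map_C.
rewrite /kdv_lin !(der0 PD, derB PD, derN PD, derD PD, derMn PD, derM PD,
  fps_map_X pD, mul0r, add0r, RP, R1P, R2P).
move: hb h0 h1 hs; rewrite /kdv_lin -/R1 -/Q1 => hb h0 h1 hs.
(* The second derivative of s s_b' - s' s_b brings in third derivatives of s_b and of s. The linear
   relations [hb] and [hs] remove them; the multipliers of z and w are the coefficients of these
   terms. *)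
have comb x y z w : x = 0 -> y = 0 -> z = 0 -> w = 0 ->
  x - X * y - (X * X * s * s * z) *+ 2 + (X * s * R * w) *+ 2 = 0 :> fps A.
  by move=> -> -> -> ->; ring.
by rewrite -[RHS](comb _ _ _ _ h0 h1 hb hs); ring.
Qed.
Lemma flow_recursion (a b : nat) : D b (s a.+1) =
  D b.+1 (s a) + s a * p (s b) - p (s a) * s b.
Proof.
have /(congr1 (fun f : fps A => f a.+1)) := flow_recursion_series b.
by rewrite fpsXMS fpsBE fpsDE [s * _]mulrC [P s * _]mulrC !fpsCME mulrC [s b * _]mulrC.
Qed.

(** The Wronskian s_a s_b' - s_a' s_b in [flow_recursion] is antisymmetric, so it cancels when the
    recursion is used once for each index. *)
Lemma flow_s_sym (a b : nat) : D b (s a) = D a (s b).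
Proof.
elim: a b => [|a IH] b; first by rewrite flow0 s0 (der1 (flow_derivation b)).
rewrite flow_recursion IH flow_recursion; ring.
Qed.

Lemma flow_comm (a b : nat) x : D a (D b x) = D b (D a x).
Proof.
have Diter m n y : D m (iter n p y) = iter n p (D m y).
  by elim: n => //= n <-; rewrite flow_prime.
apply: dp_deriv_comm => k; rewrite -/(D a _) -/(D b _).
by rewrite !(derN (flow_derivation _)) !(derMn (flow_derivation _)) !Diter flow_s_sym.
Qed.

(** * The reciprocal series, hooks and zeta *)

Variable r : fps A.
Hypothesis sr : s * r = 1.

Lemma kdv_r0 : r 0%N = 1.
Proof. by have /(congr1 (fun f : fps A => f 0%N)) := sr; rewrite fpsM0 s0 mul1r. Qed.

Lemma flow_r_recursion (a b : nat) : D b (r a.+1) = D b.+1 (r a) - p (r a * s b).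
Proof.
have DD m := fps_map_derivation (flow_derivation m).
have Dr m : fps_map (D m) r = - (r * r * fps_map (D m) s).
  apply/eqP; rewrite -subr_eq0; apply/eqP/(fps_unit_cancel s0).
  have := congr1 (fps_map (D m)) sr; rewrite (derM (DD m)) (der1 (DD m)) => h.
  rewrite mulrBr mulrN opprK -[RHS]h -!mulrA [s * (r * _)]mulrA sr mul1r.
  by rewrite addrC [r * _]mulrC.
have Pr : P r = - (r * r * P s).
  apply/eqP; rewrite -subr_eq0; apply/eqP/(fps_unit_cancel s0).
  have := congr1 P sr; rewrite (derM PD) (der1 PD) => h.
  rewrite mulrBr mulrN opprK -[RHS]h -!mulrA [s * (r * _)]mulrA sr mul1r.
  by rewrite addrC [r * _]mulrC.
have : fps_map (D b) r = X * (fps_map (D b.+1) r - P (fpsC (s b) * r)).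
  rewrite (derM PD) fps_map_C // Pr !Dr flow_recursion_series.
  set R := fpsC (s b); set R1 := fpsC _; set Y1 := fps_map _ _.
  have -> : - (r * r * (X * (Y1 + s * R1 - P s * R))) =
    - (X * (r * r * Y1 + r * (s * r) * R1 - r * r * P s * R)) by ring.
  by rewrite sr; ring.
move/(congr1 (fun f : fps A => f a.+1)).
by rewrite fpsXMS fpsBE /fps_map fpsCME mulrC.
Qed.

(* The generating function of the hooks is (s(w) r(z) - 1) / (z^2 - w^2). *)
Definition hook (a b : nat) : A := \sum_(i < a) r i * s (a + b - i.+1)%N.

Lemma hookS (a b : nat) : hook a.+1 b = hook a b.+1 + r a * s b.
Proof.
rewrite /hook big_ord_recr /= subSS addKn; congr (_ + _).
by apply: eq_bigr => i _; rewrite addSn addnS.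
Qed.

(** [hookS] and [flow_r_recursion] are parallel recursions: the product r_a s_b that the hook gains
    is the one differentiated in the other. *)
Lemma prime_hook (a b : nat) : p (hook a b) = - D b (r a).
Proof.
elim: a b => [|a IH] b.
  by rewrite /hook big_ord0 (der0 pD) kdv_r0 (der1 (flow_derivation _)) oppr0.
by rewrite hookS (derD pD) IH flow_r_recursion opprB addrC.
Qed.

Lemma hook_const (a b : nat) : (0 < b)%N -> dp_const (hook a b) = 0.
Proof.
move=> b0; rewrite dp_const_sum big1 // => i _; rewrite dp_constM (@kdv_const (_ - _)) ?mulr0 //.
by have := ltn_ord i; lia.
Qed.

Lemma hook_closed (n m k : nat) : (0 < m)%N -> (0 < k)%N ->
  D k (hook n m) = D m (hook n k).
Proof.
move=> m0 k0; apply: dp_prime_inj; first by rewrite !flow_const.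
by rewrite -!flow_prime !prime_hook !(derN (flow_derivation _)) flow_comm.
Qed.

(** Put phi = s'/s and theta = x d/dx. Since s phi = s', the series s theta(2 phi' + phi^2) is the
    total derivative 2 (s theta(phi))', which is the origin of this formula. It is twice the g of
    the overview. *)
Definition kdv_g : fps A := X * (s * fps_theta (P s * r)).

(* Applying x d/dx to the quadratic relation divided by s^2. *)
Lemma resolvent_inverse (n : nat) : r n *+ 2 - r n *+ (4 * n) = s n *+ 2 + p (kdv_g n).
Proof.
have TD := @fps_theta_derivation A.
have [phi phiE] : exists phi, phi = P s * r by eexists.
have Pphi : P phi = P (P s) * r - phi * phi.
  rewrite {1}phiE (derM PD).
  have := congr1 P sr; rewrite (derM PD) (der1 PD) => h.
  have -> : P r = - (r * phi).
    apply/eqP; rewrite -subr_eq0; apply/eqP/(fps_unit_cancel s0).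
    by rewrite mulrBr mulrN opprK mulrA sr mul1r -[RHS]h phiE addrC.
  by rewrite phiE; ring.
(* A Riccati equation for phi, in which u stands alone and is killed by [fps_theta]. *)
have q : (1 - r * r) *+ 4 = X * (P phi *+ 2 + phi * phi - uu *+ 4).
  have := congr1 (fun f => r * r * f) sQ.2; rewrite /kdv_rhs => h.
  have e1 : r * r * ((s * s - 1) *+ 4) = ((s * r) * (s * r) - r * r) *+ 4 by ring.
  move: h; rewrite e1 sr mul1r => ->; rewrite Pphi phiE.
  have -> : r * r * (X * ((s * P (P s)) *+ 2 - P s * P s - uu * (s * s) *+ 4)) =
    X * (((s * r) * (P (P s) * r)) *+ 2 - (P s * r) * (P s * r) - uu * ((s * r) * (s * r)) *+ 4) by ring.
  by rewrite sr; ring.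
have Tu : fps_theta uu = 0.
  by apply/funext => -[|k]; rewrite /fps_theta ?mulr0n //= mul0rn.
have h : (r *+ 2 - (fps_theta r) *+ 4) = s *+ 2 + P kdv_g.
  rewrite /kdv_g (derM PD) fps_map_X // mul0r add0r (derM PD) -phiE.
  have := congr1 (@fps_theta A) q.
  rewrite (derMn TD) (derB TD) (der1 TD) !(derM TD) fps_theta_X.
  rewrite !(derB TD, derD TD, derMn TD, derM TD) Tu.
  rewrite fps_theta_map // -q => h.
  have {h} h := congr1 (fun f => s * f) h.
  apply: (@fps_mulrn_inj 1).
  have ep : P s = s * phi by rewrite phiE mulrCA sr mulr1.
  move/eqP: h; rewrite -subr_eq0 => /eqP h.
  apply/eqP; rewrite -subr_eq0; apply/eqP; rewrite -[RHS]h ep.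
  have e1 : s * ((0 - (fps_theta r * r + r * fps_theta r)) *+ 4) = - ((s * r) * fps_theta r) *+ 8 by ring.
  have e2 : s * ((1 - r * r) *+ 4) = (s - (s * r) * r) *+ 4 by ring.
  rewrite e1 [s * (_ + _)]mulrDr e2 sr; ring.
move/(congr1 (fun f : fps A => f n)): h.
by rewrite fpsBE fpsDE !fpsMnE /fps_theta -mulrnA mulnC.
Qed.

(** An explicit antiderivative of D_m s_n, read off from [resolvent_inverse] and [prime_hook]. *)
Definition kdv_zeta (n m : nat) : A :=
  hook n m *+ n.*2 - hook n m - (2%:R : C)^-1 *: D m (kdv_g n).

Lemma half_mulr2n a : ((2%:R : C)^-1 *: a) *+ 2 = a.
Proof. by rewrite -scaler_nat scalerA mulfV ?pnatr_eq0 // scale1r. Qed.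

Lemma prime_zeta (n m : nat) : p (kdv_zeta n m) = D m (s n).
Proof.
apply: (@dp_mulrn_inj 1); rewrite /kdv_zeta !(derB pD) (derMn pD) dp_primeZ.
rewrite !mulrnBl half_mulr2n !prime_hook -flow_prime.
have := congr1 (D m) (resolvent_inverse n).
rewrite (derB (flow_derivation _)) !(derMn (flow_derivation _)) => h.
have -> : D m (p (kdv_g n)) =
    (D m (r n) *+ 2 - D m (r n) *+ (4 * n)) - D m (s n) *+ 2.
  by rewrite h (derD (flow_derivation m)) (derMn (flow_derivation m)) addrAC subrr add0r.
rewrite -muln2; ring.
Qed.

Lemma zeta_const (n m : nat) : (0 < m)%N -> dp_const (kdv_zeta n m) = 0.
Proof.
move=> m0; rewrite /kdv_zeta !dp_constB dp_constMn hook_const // mul0rn.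
by rewrite dp_constZ flow_const mulr0 !subr0.
Qed.

Lemma zeta_closed (n m k : nat) : (0 < m)%N -> (0 < k)%N ->
  D k (kdv_zeta n m) = D m (kdv_zeta n k).
Proof.
move=> m0 k0; apply: dp_prime_inj; first by rewrite !flow_const.
by rewrite -!flow_prime !prime_zeta flow_comm.
Qed.

Lemma hook_zeta (n m : nat) : ((n.*2)%:R - 1) *: hook n m =
  kdv_zeta n m + D m ((2%:R : C)^-1 *: kdv_g n).
Proof. by rewrite flowZ /kdv_zeta subrK scalerBl scaler_nat scale1r. Qed.

(** * Grading *)

Definition euler : A -> A := dp_deriv (fun i => (i + 2)%:R *: u_ i).

Lemma euler_derivation : derivation euler.
Proof. exact: dp_deriv_derivation. Qed.
Let ED := euler_derivation.

(** Homogeneity as an eigenvalue condition for the Euler derivation, u^(k) having weight k+2: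
    products and flows are then handled by the Leibniz rule and commutators instead of monomials. *)
Definition hom (d : nat) a : Prop := euler a = a *+ d.

Lemma hom0 d : hom d 0. Proof. by rewrite /hom (der0 ED) mul0rn. Qed.
Lemma hom1 : hom 0 1. Proof. by rewrite /hom (der1 ED) mulr0n. Qed.
Lemma homD d a b : hom d a -> hom d b -> hom d (a + b).
Proof. by rewrite /hom (derD ED) => -> ->; rewrite mulrnDl. Qed.
Lemma homZ d c a : hom d a -> hom d (c *: a).
Proof. by rewrite /hom /euler dp_derivZ => ->; rewrite scalerMnr. Qed.
Lemma homMn d n a : hom d a -> hom d (a *+ n).
Proof. by rewrite -scaler_nat; exact: homZ. Qed.
Lemma homN d a : hom d a -> hom d (- a).
Proof. by rewrite -scaleN1r; exact: homZ. Qed.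
Lemma homM d e a b : hom d a -> hom e b -> hom (d + e) (a * b).
Proof. by rewrite /hom (derM ED) => -> ->; rewrite mulrnAl mulrnAr mulrnDr. Qed.
Lemma hom_sum d I (t : seq I) (Q : pred I) F :
  (forall i, Q i -> hom d (F i)) -> hom d (\sum_(i <- t | Q i) F i).
Proof. by move=> h; apply: big_ind => //; [exact: hom0|exact: homD]. Qed.
Lemma hom_prod I (t : seq I) (Q : pred I) F (w : I -> nat) :
  (forall i, hom (w i) (F i)) ->
  hom (\sum_(i <- t | Q i) w i)%N (\prod_(i <- t | Q i) F i).
Proof.
by move=> h; elim/big_ind2: _ => // [|d a e b]; [exact: hom1|exact: homM].
Qed.
Lemma hom_exp d a n : hom d a -> hom (d * n) (a ^+ n).
Proof.
by move=> h; elim: n => [|n IH]; [rewrite muln0; exact: hom1|rewrite exprS mulnS; exact: homM].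
Qed.
Lemma homMn_inv d n a : hom d (a *+ n.+1) -> hom d a.
Proof.
by rewrite /hom (derMn ED) => h; apply: (@dp_mulrn_inj n); rewrite h -!mulrnA mulnC.
Qed.
Lemma hom_mon m : hom (weight_by (fun i => i + 2)%N m) (dp_mon A m).
Proof. by rewrite /hom /euler dp_deriv_diag_mon scaler_nat. Qed.

Lemma hom_coef d a m : hom d a -> weight_by (fun i => i + 2)%N m <> d -> dp_coef m a = 0.
Proof.
move=> ha md; have := dp_deriv_diag (fun i => i + 2)%N a m.
rewrite -/(euler a) ha -scaler_nat dp_coefZ => /eqP.
rewrite -subr_eq0 -mulrBl mulf_eq0 subr_eq0 eqr_nat => /orP[/eqP e|/eqP //].
by case: md; rewrite e.
Qed.

Lemma euler_prime a : euler (p a) = p (euler a) + p a.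
Proof.
apply/eqP; rewrite addrC -subr_eq; apply/eqP; move: a; apply: derivation_ext.
- split=> [x y|x y]; first by rewrite !(derD pD, derD ED) opprD addrACA.
  by rewrite !(derM pD, derM ED, derD pD, derD ED); ring.
- exact: pD.
- by move=> c x; rewrite /euler !(dp_primeZ, dp_derivZ) scalerBr.
- exact: dp_primeZ.
- move=> k; rewrite /euler /dp_prime !dp_deriv_uvar dp_derivZ dp_deriv_uvar.
  by rewrite -scalerBl -natrB ?addSn // subSnn scale1r.
Qed.

Lemma hom_prime d a : hom d a -> hom d.+1 (p a).
Proof. by rewrite /hom euler_prime => ->; rewrite (derMn pD) mulrSr. Qed.

Lemma hom_prime_inv d a : dp_const a = 0 -> hom d.+1 (p a) -> hom d a.
Proof.
move=> ca; rewrite /hom euler_prime mulrSr => /addIr h; apply: dp_prime_inj.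
  rewrite dp_constMn ca mul0rn; apply: dp_const_deriv => k.
  by rewrite dp_constZ dp_const_uvar mulr0.
by rewrite h (derMn pD).
Qed.

Lemma hom_u0 : hom 2 (u_ 0).
Proof. by rewrite /hom /euler dp_deriv_uvar scaler_nat. Qed.

Lemma hom_s n : hom n.*2 (s n).
Proof.
elim: n => [|n IH]; first by rewrite s0; exact: hom1.
rewrite doubleS; apply: hom_prime_inv; first exact: kdv_const.
apply: (@homMn_inv _ 3); rewrite kdv_linear.
have h1 := hom_prime IH; have h3 := hom_prime (hom_prime h1).
apply: homD; first apply: homD => //.
  by apply/homN/homMn; have := homM hom_u0 h1; rewrite add2n.
by apply/homN/homMn; have := homM (hom_prime hom_u0) IH; rewrite add3n.
Qed.

(** The commutator relation [euler, D_m] = (2m-1) D_m, arranged to avoid truncated subtraction; once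
    rearranged, both sides are derivations. *)
Lemma euler_flow m a : euler (D m a) + D m a = D m (euler a) + D m a *+ m.*2.
Proof.
suff h : euler (D m a) - D m (euler a) = D m a *+ m.*2 - D m a.
  by rewrite -[euler (D m a)](subrK (D m (euler a))) h; ring.
have DD := flow_derivation m; move: a; apply: derivation_ext.
- split=> [x y|x y]; first by rewrite !(derD DD, derD ED); ring.
  by rewrite !(derM DD, derM ED, derD DD, derD ED); ring.
- split=> [x y|x y]; first by rewrite (derD DD) !mulrnDl; ring.
  by rewrite (derM DD); ring.
- by move=> c x; rewrite /euler !(flowZ, dp_derivZ) scalerBr.
- by move=> c x; rewrite flowZ scalerMnr -scalerBr.
move=> k; have hD : hom (m.*2 + k.+1) (D m (u_ k)).
  rewrite /D dp_deriv_uvar; apply/homN/homMn; elim: k.+1 => [|j IH].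
    by rewrite addn0; exact: hom_s.
  by rewrite addnS /=; exact: hom_prime.
by rewrite hD /euler dp_deriv_uvar flowZ scaler_nat -addn1 !mulrnDr; ring.
Qed.

Lemma hom_flow d m a : (0 < m)%N -> hom d a -> hom (d + m.*2.-1) (D m a).
Proof.
case: m => // m _ ha; have := euler_flow m.+1 a; rewrite ha (derMn (flow_derivation _)).
move=> h; apply: (addIr (D m.+1 a)); rewrite h -mulrnDr -mulrSr doubleS /=.
by rewrite addnS.
Qed.

Lemma hom_zeta n m : (0 < n)%N -> (0 < m)%N -> hom (n.*2 + m.*2 - 2) (kdv_zeta n m).
Proof.
move=> n0 m0; apply: hom_prime_inv; first exact: zeta_const.
rewrite prime_zeta; have := hom_flow m0 (hom_s n).
by congr (hom _ _); lia.
Qed.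

Lemma hom_det n (M : 'M[A]_n) (v w : 'I_n -> nat) :
  (forall i j, hom (v i + w j) (M i j)) ->
  hom (\sum_i v i + \sum_i w i)%N (\det M).
Proof.
move=> hM; apply: hom_sum => sg _.
have h : hom (\sum_i (v i + w (sg i)))%N (\prod_i M i (sg i)).
  by apply: hom_prod => i; exact: hM.
rewrite big_split /= -(reindex_inj (@perm_inj _ sg) (P := xpredT)) /= in h.
by case: (odd_perm sg); rewrite ?mul1r // expr1 mulN1r; exact: homN.
Qed.

(** * Submodules generated under the flows, and the graded Nakayama lemma *)

Inductive dspan (G : A -> Prop) : A -> Prop :=
| dspan_gen x of G x : dspan G x
| dspan0 : dspan G 0
| dspanD x y of dspan G x & dspan G y : dspan G (x + y)
| dspanZ c x of dspan G x : dspan G (c *: x)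
| dspan_flow m x of (0 < m)%N & dspan G x : dspan G (D m x).

(** Unlike in [dspan], the last constructor takes an arbitrary x: membership means lying in the
    linear span of G modulo the images of the flows. *)
Inductive xspan (G : A -> Prop) : A -> Prop :=
| xspan_gen x of G x : xspan G x
| xspan0 : xspan G 0
| xspanD x y of xspan G x & xspan G y : xspan G (x + y)
| xspanZ c x of xspan G x : xspan G (c *: x)
| xspan_flow m x of (0 < m)%N : xspan G (D m x).

Lemma dspan_xspan G x : dspan G x -> xspan G x.
Proof.
by elim=> *; [exact: xspan_gen|exact: xspan0|exact: xspanD|exact: xspanZ|exact: xspan_flow].
Qed.

Lemma xspan_sub G H x : (forall y, G y -> xspan H y) -> xspan G x -> xspan H x.
Proof.
by move=> GH; elim=> *; [exact: GH|exact: xspan0|exact: xspanD|exact: xspanZ|exact: xspan_flow].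
Qed.

Lemma xspanN G x : xspan G x -> xspan G (- x).
Proof. by rewrite -scaleN1r; exact: xspanZ. Qed.

Lemma xspanB G x y : xspan G x -> xspan G y -> xspan G (x - y).
Proof. by move=> hx /xspanN; exact: xspanD. Qed.

Lemma xspan_sum G I (t : seq I) (Q : pred I) F :
  (forall i, Q i -> xspan G (F i)) -> xspan G (\sum_(i <- t | Q i) F i).
Proof. by move=> h; apply: big_ind => //; [exact: xspan0|exact: xspanD]. Qed.

Lemma dspan_sum G (I : eqType) (t : seq I) (Q : pred I) F :
  (forall i, i \in t -> Q i -> dspan G (F i)) -> dspan G (\sum_(i <- t | Q i) F i).
Proof.
move=> h; rewrite big_seq_cond; apply: big_ind; [exact: dspan0|exact: dspanD|].
by move=> i /andP[]; exact: h.
Qed.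

Lemma xspan_sign G (b : bool) x : xspan G x -> xspan G ((-1) ^+ b * x).
Proof. by case: b; rewrite ?mul1r // expr1 mulN1r; exact: xspanN. Qed.

Lemma hom_decomposition a : exists2 l : seq (nat * A),
  a = \sum_(t <- l) t.2 & forall t, t \in l -> hom t.1 t.2.
Proof.
elim/dp_ind: a => [c m|a b [la -> ha] [lb -> hb]].
  exists [:: (weight_by (fun i => i + 2)%N m, c *: dp_mon A m)].
    by rewrite big_seq1.
  by move=> t; rewrite inE => /eqP -> /=; apply/homZ/hom_mon.
exists (la ++ lb); first by rewrite big_cat.
by move=> t; rewrite mem_cat => /orP[/ha|/hb].
Qed.

Lemma hom_projection d x (l : seq (nat * A)) : hom d x ->
  (forall t, t \in l -> hom t.1 t.2) -> x = \sum_(t <- l) t.2 ->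
  x = \sum_(t <- l | t.1 == d) t.2.
Proof.
have coef_sum m (k : seq (nat * A)) Q :
    dp_coef m (\sum_(t <- k | Q t) t.2) = \sum_(t <- k | Q t) dp_coef m t.2.
  exact: (big_morph _ (@dp_coefD C A m) (@dp_coef0 C A m)).
move=> hx hl xE; apply: dp_ext => m; rewrite coef_sum.
have [md|/eqP md] := eqVneq (weight_by (fun i => i + 2)%N m) d; last first.
  rewrite (hom_coef hx) // big_seq_cond big1 // => t /andP[tl /eqP td].
  by apply: hom_coef (hl _ tl) _; rewrite td.
rewrite xE coef_sum [LHS](bigID (fun t => t.1 == d)) /= [X in _ + X]big_seq_cond.
rewrite [X in _ + X]big1 ?addr0 // => t /andP[tl /eqP td].
by apply: hom_coef (hl _ tl) _; rewrite md => e; apply: td.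
Qed.

(** Flows raise the degree by 2m-1 > 0, so a homogeneous element is a combination of generators and
    of flows of elements of smaller degree; induction applies. Homogeneous generators make it
    possible to cut a decomposition down to one degree. *)
Lemma graded_nakayama G : (forall x, G x -> exists d, hom d x) ->
  (forall x, xspan G x) -> forall x, dspan G x.
Proof.
move=> Gh full.
(* Membership is stated conditionally on all smaller degrees, so that decompositions can be built
   before the induction on the degree starts. *)
pose good d z := hom d z /\ ((forall e y, (e < d)%N -> hom e y -> dspan G y) -> dspan G z).
have dec x : xspan G x -> exists2 l : seq (nat * A),
    x = \sum_(t <- l) t.2 & forall t, t \in l -> good t.1 t.2.
  elim=> {x} [x Gx||x y _ [lx -> hx] _ [ly -> hy]|c x _ [l -> hl]|m x m0].
  - have [d hd] := Gh _ Gx; exists [:: (d, x)]; first by rewrite big_seq1.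
    by move=> t; rewrite inE => /eqP ->; split=> // _; exact: dspan_gen.
  - by exists [::]; rewrite ?big_nil.
  - exists (lx ++ ly); first by rewrite big_cat.
    by move=> t; rewrite mem_cat => /orP[/hx|/hy].
  - exists [seq (t.1, c *: t.2) | t <- l]; first by rewrite big_map scaler_sumr.
    move=> t /mapP[q /hl [hq gq] ->] /=; split; first exact: homZ.
    by move/gq; exact: dspanZ.
  have [l -> hl] := hom_decomposition x.
  exists [seq (t.1 + m.*2.-1, D m t.2)%N | t <- l].
    by rewrite big_map (der_sum (flow_derivation m)).
  move=> t /mapP[q /hl hq ->] /=; split; first exact: hom_flow.
  by move=> h; apply: dspan_flow => //; apply: h hq; case: m m0 => // m _; rewrite doubleS -addn1 leq_add2l.
have homd d x : hom d x -> dspan G x.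
  have [N] := ubnP d; elim: N d x => // N IH d x dN hx.
  have [l xE hl] := dec x (full x).
  rewrite (hom_projection hx _ xE) => [|t /hl[]//].
  apply: dspan_sum => t tl /eqP td; apply: (hl t tl).2 => e y; rewrite td => ed.
  by apply: IH; apply: leq_trans ed _; rewrite -ltnS.
move=> x; have [l -> hl] := hom_decomposition x.
by apply: dspan_sum => t /hl ht _; apply: homd ht.
Qed.

(** * Minors *)

Lemma der_prod (d : A -> A) (I : eqType) (t : seq I) (F : I -> A) :
  derivation d -> uniq t ->
  d (\prod_(i <- t) F i) = \sum_(i <- t) d (F i) * \prod_(k <- t | k != i) F k.
Proof.
move=> dD; elim: t => [|j t IH] /=; first by rewrite !big_nil (der1 dD).
case/andP=> jt ut; rewrite !big_cons (derM dD) IH // eqxx /=; congr (_ * _ + _).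
  by rewrite big_seq [RHS]big_seq_cond; apply: eq_bigl => i;
     case: eqP => [->|]; rewrite ?(negbTE jt) ?andbT.
rewrite mulr_sumr !big_seq; apply: eq_bigr => i it; rewrite big_cons.
have -> : j != i by apply: contraNneq jt => ->.
by rewrite mulrCA.
Qed.

Lemma sum_perm_swap0 n (i0 i : 'I_n) (F : 'S_n -> A) : i != i0 ->
  (forall sg, F (tperm i0 i * sg)%g = - F sg) -> \sum_sg F sg = 0.
Proof.
move=> ii0 Fs; apply: (@dp_mulrn_inj 1); rewrite mul0rn mulr2n.
rewrite {2}(reindex_inj (mulgI (tperm i0 i))) /=.
by under [X in _ + X]eq_bigr do rewrite Fs; rewrite sumrN subrr.
Qed.

(* If row i0 is dg and the other rows are closed 1-forms, then
   dg /\ w = d (g w). *)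
Lemma det_exact_row G n (M : 'M[A]_n) (m : 'I_n -> nat) (i0 : 'I_n) (g : A) :
  (forall j, 0 < m j)%N -> (forall j, M i0 j = D (m j) g) ->
  (forall i j k, i != i0 -> D (m k) (M i j) = D (m j) (M i k)) ->
  xspan G (\det M).
Proof.
move=> m0 Mi0 Mcl.
pose t := [seq i <- index_enum 'I_n | i != i0].
have ut : uniq t by rewrite filter_uniq // index_enum_uniq.
pose Pi (sg : 'S_n) := \prod_(i <- t) M i (sg i).
have -> : \det M = \sum_(sg : 'S_n) (-1) ^+ sg * D (m (sg i0)) (g * Pi sg)
    - g * \sum_(sg : 'S_n) (-1) ^+ sg * D (m (sg i0)) (Pi sg).
  rewrite mulr_sumr -sumrB; apply: eq_bigr => sg _.
  rewrite (bigD1 i0) //= Mi0 -big_filter -/t -/(Pi sg).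
  by rewrite (derM (flow_derivation _)) mulrDr [X in _ = _ + X - _]mulrCA addrK.
(* A product of closed 1-forms is closed: by [Mcl] the Leibniz term at i is unchanged when the
   images of i0 and i are exchanged, while the sign flips. *)
have -> : \sum_(sg : 'S_n) (-1) ^+ sg * D (m (sg i0)) (Pi sg) = 0.
  under eq_bigr do rewrite (der_prod _ (flow_derivation _) ut) mulr_sumr.
  rewrite exchange_big big_seq big1 // => i.
  rewrite mem_filter => /andP[ii0 _]; apply: (sum_perm_swap0 ii0) => sg.
  rewrite odd_permM odd_tperm eq_sym ii0 /= signrN mulNr; congr (- (_ * _)).
  rewrite !permM tpermL tpermR Mcl //; congr (_ * _).
  rewrite big_seq_cond [RHS]big_seq_cond; apply: eq_bigr => k.
  rewrite mem_filter => /andP[/andP[ki0 _] ki].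
  by rewrite permM tpermD // eq_sym.
rewrite mulr0 subr0; apply: xspan_sum => sg _; apply: xspan_sign.
exact: xspan_flow.
Qed.

(** Rows are replaced one at a time: by [hook_zeta] the two versions of a row differ by an exact
    form, the other rows are closed, and [det_exact_row] applies. The scale factors 2 v_i - 1 are
    odd, hence nonzero. *)
Lemma det_hook_zeta G n (v m : 'I_n -> nat) : (forall j, 0 < m j)%N ->
  xspan G (\det (\matrix_(i, j) kdv_zeta (v i) (m j))) <->
  xspan G (\det (\matrix_(i, j) hook (v i) (m j))).
Proof.
move=> m0; pose c (i : nat) : C := i.*2%:R - 1.
have c0 i : c i != 0.
  rewrite subr_eq0; apply/eqP; rewrite -[1]/(1%:R) => /eqP; rewrite eqr_nat => /eqP.
  by lia.
pose h i j := c (v i) *: hook (v i) (m j).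
pose hyb k := \matrix_(i < n, j < n)
  (if (i < k)%N then kdv_zeta (v i) (m j) else h i j).
have hybS k : (k < n)%N -> xspan G (\det (hyb k) - \det (hyb k.+1)).
  move=> kn; pose i0 := Ordinal kn.
  pose B := \matrix_(i < n, j < n) if i == i0 then
     D (m j) ((2%:R : C)^-1 *: kdv_g (v i)) else hyb k i j.
  have -> : \det (hyb k) = 1 * \det (hyb k.+1) + 1 * \det B.
    apply: (determinant_multilinear (i0 := i0)).
    - apply/rowP => j; rewrite !mxE eqxx /= ltnn ltnSn !mul1r /h hook_zeta //.
    - apply/matrixP => i j; rewrite !mxE; congr (if _ then _ else _).
      by have := neq_lift i0 i; rewrite -val_eqE /=; move: (bump _ _) => x; lia.
    - by apply/matrixP => i j; rewrite !mxE eq_sym (negbTE (neq_lift i0 i)).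
  rewrite !mul1r addrC addKr; apply: (@det_exact_row _ _ _ m i0 ((2%:R : C)^-1 *: kdv_g (v i0))) => //.
    by move=> j; rewrite !mxE eqxx.
  move=> i j k' ii0; rewrite !mxE (negbTE ii0); case: ifP => _; first exact: zeta_closed.
  by rewrite /h !flowZ hook_closed.
have hybn k : (k <= n)%N -> xspan G (\det (hyb 0) - \det (hyb k)).
  elim: k => [|k IH] kn; first by rewrite subrr; exact: xspan0.
  rewrite -[X in xspan _ X](subrKA (\det (hyb k))); apply: xspanD; last exact: hybS.
  by apply: IH; exact: ltnW.
have e1 : \det (hyb n) = \det (\matrix_(i, j) kdv_zeta (v i) (m j)).
  by congr (\det _); apply/matrixP => i j; rewrite !mxE ltn_ord.
have e0 : \det (hyb 0) = (\prod_i c (v i)) *: \det (\matrix_(i, j) hook (v i) (m j)).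
  rewrite /determinant scaler_sumr; apply: eq_bigr => sg _.
  rewrite scalerAr; congr (_ * _); rewrite -scaler_prod.
  by apply: eq_bigr => i _; rewrite !mxE.
have := hybn n (leqnn n); rewrite e1 e0; set y := \det _; set z := \det _ => hzy.
have p0 : \prod_i c (v i) != 0 by apply/prodf_neq0.
split=> [hz|hy].
  have : xspan G (\prod_i c (v i) *: y) by rewrite -[X in xspan _ X](subrK z); exact: xspanD.
  move/(xspanZ (\prod_i c (v i))^-1).
  by rewrite scalerA mulVf // scale1r.
rewrite -[z](subKr (\prod_i c (v i) *: y)); apply: xspanB => //; exact: xspanZ.
Qed.

(** Describes the matrices met in [jacobi_trudi_hook]. Expansion along an indicator row leaves
    signed minors of the same kind; when only hook rows remain, the transpose is a hook
    determinant. *)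
Lemma det_hook_delta_rows G :
  (forall n (v m : 'I_n -> nat), (forall i, 0 < v i)%N -> (forall j, 0 < m j)%N ->
     xspan G (\det (\matrix_(i, j) hook (v i) (m j)))) ->
  forall n (v : 'I_n -> nat) (M : 'M[A]_n), (forall j, 0 < v j)%N ->
  (forall i, (exists2 q, (0 < q)%N & forall j, M i j = hook (v j) q) \/
             (exists x, forall j, M i j = (v j == x)%:R)) ->
  xspan G (\det M).
Proof.
move=> hooks; elim=> [|n IH] v M v0 rows.
  rewrite det_mx00 -(det_mx00 (\matrix_(i < 0, j < 0) hook (v i) (v j))); exact: hooks.
have [[i [x Mi]]|nodelta] := pselect (exists i, exists x, forall j, M i j = (v j == x)%:R).
  rewrite (expand_det_row _ i); apply: xspan_sum => j _; rewrite Mi.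
  case: eqP => _; last by rewrite mul0r; exact: xspan0.
  rewrite mul1r /cofactor -signr_odd; apply: xspan_sign.
  apply: (IH (fun t => v (lift j t))) => // k; have [[q q0 hq]|[y hy]] := rows (lift i k).
    by left; exists q => // t; rewrite !mxE hq.
  by right; exists y => t; rewrite !mxE hy.
have hookrows i : exists q, (0 < q)%N /\ forall j, M i j = hook (v j) q.
  have [[q q0 hq]|del] := rows i; first by exists q.
  by case: nodelta; exists i.
have [q hq] := fin_all_exists hookrows.
rewrite -det_tr; suff -> : M^T = \matrix_(i, j) hook (v i) (q j).
  by apply: hooks => // j; exact: (hq j).1.
by apply/matrixP => i j; rewrite !mxE (hq j).2.
Qed.

(** Entry of a Jacobi-Trudi matrix, with s_j in the role of the complete symmetric function h_j. The
    test enforces h_j = 0 for j < 0, where truncated subtraction would give s_0 = 1. *)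
Definition shifted (k i : nat) : A := if (i <= k)%N then s (k - i)%N else 0.

(* Multiplication by the unitriangular Toeplitz matrix of r turns the
   Jacobi-Trudi matrix into unit rows and rows of hooks (Giambelli). *)
Lemma jacobi_trudi_hook G :
  (forall n (v m : 'I_n -> nat), (forall i, 0 < v i)%N -> (forall j, 0 < m j)%N ->
     xspan G (\det (\matrix_(i, j) hook (v i) (m j)))) ->
  forall N (k : 'I_N -> nat), xspan G (\det (\matrix_(b, i < N) shifted (k b) i)).
Proof.
move=> hooks N k; pose U := \matrix_(q < N, t < N) (if (t <= q)%N then r (q - t)%N else 0).
have detU : \det U = 1.
  rewrite det_trig; first by rewrite big1 // => i _; rewrite mxE leqnn subnn kdv_r0.
  by apply/is_trig_mxP => i j ij; rewrite mxE leqNgt ij.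
rewrite -[\det _]mulr1 -detU -det_mulmx.
apply: (det_hook_delta_rows hooks (v := fun t => (N - t)%N)) => [t|b].
  by rewrite subn_gt0.
have entry (t : 'I_N) : (\matrix_(b, i < N) shifted (k b) i *m U) b t =
    \sum_(0 <= i < N - t) shifted (k b) (i + t)%N * r i.
  rewrite mxE; under eq_bigr do rewrite !mxE.
  rewrite -(big_mkord xpredT (fun q => shifted (k b) q * (if (t <= q)%N then r (q - t)%N else 0))).
  rewrite (big_cat_nat (n := t)) //=; last exact: ltnW.
  rewrite big_nat big1 ?add0r; last first.
    by move=> i /andP[_ it]; rewrite leqNgt it mulr0.
  rewrite -{1}[t : nat]add0n big_addn; apply: eq_bigr => i _.
  by rewrite leq_addl addnK.
(* The entry is coefficient k_b - t of s r with the index of r cut below N - t. For k_b >= N this is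
   a hook with second index k_b - N + 1; for k_b < N the cut loses nothing, and s r = 1 gives an
   indicator. *)
have [Nk|kN] := leqP N (k b).
  left; exists (k b - N).+1 => // t; rewrite entry big_mkord /hook.
  apply: eq_bigr => i _; have := ltn_ord i; have := ltn_ord t => tN it.
  rewrite /shifted ifT; last lia.
  by rewrite mulrC; congr (_ * s _); lia.
right; exists (N - k b)%N => t; rewrite entry; have tN := ltn_ord t.
have [tk|kt] := leqP t (k b); last first.
  rewrite big_nat big1 => [|i /andP[_ it]]; last by rewrite /shifted ifF ?mul0r //; lia.
  by rewrite (_ : (_ == _) = false) //; lia.
rewrite (big_cat_nat (n := (k b - t).+1)) //=; last lia.
rewrite [X in _ + X]big_nat [X in _ + X]big1 => [|i /andP[ki it]]; last first.
  by rewrite /shifted ifF ?mul0r //; lia.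
rewrite addr0 big_mkord; have := congr1 (fun f : fps A => f (k b - t)%N) sr.
rewrite mulrC fpsME fps1E.
have -> : (k b - t == 0)%N = (N - t == N - k b)%N by lia.
move=> <-; apply: eq_bigr => i _; have := ltn_ord i => ik.
rewrite /shifted ifT; last lia.
by rewrite mulrC; congr (_ * s _); lia.
Qed.

(* The transition matrix from Jacobi-Trudi determinants to monomials is
   unitriangular for the order given by the sum of the squared exponents. *)
Lemma xspan_s_monomial G :
  (forall N (k : 'I_N -> nat), xspan G (\det (\matrix_(b, i < N) shifted (k b) i))) ->
  forall N (n : 'I_N -> nat), xspan G (\prod_b s (n b)).
Proof.
(* The other monomials of the expansion keep the sum of the exponents and increase the sum of
   squares, which is bounded by the square of the sum. *)
move=> JT N n; have [B] := ubnP ((\sum_b n b) ^ 2 - \sum_b n b ^ 2)%N.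
elim: B n => // B IH n0 n0B.
pose wt (t : 'S_N) := (\sum_(b < N) b * n0 (t b))%N.
(* Reorders the exponents so that the sum of b n_b is maximal, as [sumn_sqr_shift] demands. With k_b
   = n_b + b below, the identity permutation contributes the monomial itself. *)
pose tau : 'S_N := [arg max_(t > 1%g) wt t].
have tau_max t : (wt t <= wt tau)%N by rewrite /tau; case: arg_maxnP => // i _; apply.
pose n b := n0 (tau b).
have reind (T : Type) (idx : T) (op : Monoid.com_law idx) (F : nat -> T) :
    \big[op/idx]_b F (n0 b) = \big[op/idx]_b F (n b).
  by rewrite (reindex_inj (@perm_inj _ tau)).
rewrite reind; move: n0B; rewrite (reind _ 0%N addn id) (reind _ 0%N addn (fun x => x ^ 2)%N).
move=> /= nB; have nmax (sg : 'S_N) : (\sum_(b < N) sg b * n b <= \sum_(b < N) b * n b)%N.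
  apply: leq_trans (tau_max (sg^-1 * tau)%g); rewrite /wt [X in (_ <= X)%N](reindex_inj (@perm_inj _ sg)) /=.
  by under [X in (_ <= X)%N]eq_bigr do rewrite permM permK.
have detE := JT N (fun b => n b + b)%N; rewrite /determinant (bigD1 1%g) //= in detE.
rewrite odd_perm1 mul1r in detE.
set M := \matrix_(b, i) _ in detE.
have -> : \prod_b s (n b) = \prod_i M i ((1%g : 'S_N) i).
  by apply: eq_bigr => b _; rewrite mxE perm1 /shifted leq_addl addnK.
set Pd := \prod_i _ in detE *; set rest := \sum_(sg | _) _ in detE.
rewrite -[Pd](addrK rest); apply: xspanB => //; apply: xspan_sum => sg sg1.
apply: xspan_sign.
have [all_le|] := boolP [forall b, sg b <= n b + b]%N; last first.
  rewrite negb_forall => /existsP[b]; rewrite -ltnNge => lt.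
  rewrite (bigD1 b) //= mxE /shifted leqNgt lt mul0r; exact: xspan0.
move/forallP: all_le => le.
pose n' b := (n b + b - sg b)%N.
have nn' b : (n' b + sg b = n b + b)%N by rewrite /n' subnK.
have -> : \prod_i M i (sg i) = \prod_b s (n' b).
  by apply: eq_bigr => b _; rewrite mxE /shifted le.
apply: IH.
have sumE : (\sum_b n' b = \sum_b n b)%N.
  apply: (@addIn (\sum_(b < N) b)%N); rewrite -[RHS]big_split /=.
  under [RHS]eq_bigr do rewrite -nn'.
  by rewrite big_split /=; congr (_ + _)%N; rewrite (reindex_inj (@perm_inj _ sg)).
have sqlt := sumn_sqr_shift sg1 nn' (nmax sg).
have sqle (F : 'I_N -> nat) : (\sum_b F b ^ 2 <= (\sum_b F b) ^ 2)%N.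
  rewrite -mulnn big_distrl /=; apply: leq_sum => i _.
  by rewrite -mulnn leq_mul2l (bigD1 i) //= leq_addr orbT.
have := sqle n'; rewrite sumE => le'.
apply: (leq_trans (ltn_sub2l (leq_trans sqlt le') sqlt)); exact: nB.
Qed.
End KdVSeries.

(** * The subalgebra generated by the coefficients of s *)

Section SPoly.
Variables (C : numFieldType) (A : dpoly C) (s r : fps A).
Hypotheses (sQ : kdv_quadratic s) (sr : s * r = 1).

Inductive spoly : A -> Prop :=
| spoly_s i : spoly (s i)
| spoly0 : spoly 0
| spoly1 : spoly 1
| spolyD x y of spoly x & spoly y : spoly (x + y)
| spolyZ c x of spoly x : spoly (c *: x)
| spolyM x y of spoly x & spoly y : spoly (x * y).

Lemma spolyE x : spoly x -> exists l : seq (C * seq nat),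
  x = \sum_(t <- l) t.1 *: \prod_(i <- t.2) s i.
Proof.
elim=> {x} [i|||x y _ [k ->] _ [l ->]|c x _ [l ->]|x y _ [k ->] _ [l ->]].
- by exists [:: (1, [:: i])]; rewrite big_seq1 big_seq1 scale1r.
- by exists [::]; rewrite big_nil.
- by exists [:: (1, [::])]; rewrite big_seq1 big_nil scale1r.
- by exists (k ++ l); rewrite big_cat.
- exists [seq (c * t.1, t.2) | t <- l]; rewrite big_map scaler_sumr.
  by apply: eq_bigr => t _; rewrite scalerA.
exists [seq (t.1 * q.1, t.2 ++ q.2) | t <- k, q <- l].
rewrite big_allpairs_dep big_distrl; apply: eq_bigr => t _.
rewrite big_distrr; apply: eq_bigr => q _ /=.
by rewrite big_cat -scalerAl -scalerAr scalerA.
Qed.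

Lemma spoly_sum I (t : seq I) (P : pred I) F :
  (forall i, P i -> spoly (F i)) -> spoly (\sum_(i <- t | P i) F i).
Proof. by move=> h; apply: big_ind => //; [exact: spoly0|exact: spolyD]. Qed.

Lemma spoly_prod I (t : seq I) (P : pred I) F :
  (forall i, P i -> spoly (F i)) -> spoly (\prod_(i <- t | P i) F i).
Proof. by move=> h; apply: big_ind => //; [exact: spoly1|exact: spolyM]. Qed.

Lemma spoly_r n : spoly (r n).
Proof.
have [N] := ubnP n; elim: N n => // N IH [|n] nN; first by rewrite (kdv_r0 sQ sr); exact: spoly1.
have := congr1 (fun f : fps A => f n.+1) sr.
rewrite fpsME fps1E big_ord_recl (kdv_s0 sQ) mul1r subn0 => /eqP.
rewrite addr_eq0 => /eqP ->; rewrite -scaleN1r; apply/spolyZ/spoly_sum => i _.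
apply: spolyM; first exact: spoly_s.
by apply: IH; rewrite /= /bump; lia.
Qed.

Lemma spoly_det_hook n (v m : 'I_n -> nat) :
  spoly (\det (\matrix_(i, j) hook s r (v i) (m j))).
Proof.
apply: spoly_sum => sg _; apply: spolyM.
  by case: (odd_perm sg); rewrite ?expr1 -?scaleN1r //; [apply: spolyZ|]; exact: spoly1.
apply: spoly_prod => i _; rewrite mxE; apply: spoly_sum => k _.
by apply: spolyM; [exact: spoly_r|exact: spoly_s].
Qed.

Lemma spoly_xspan (G : A -> Prop) x :
  (forall l : seq nat, xspan s G (\prod_(i <- l) s i)) -> spoly x -> xspan s G x.
Proof.
by move=> h /spolyE[l ->]; apply: xspan_sum => t _; apply/xspanZ/h.
Qed.
End SPoly.

(** * The evaluation maps *)

(* Over [malg_dpoly] the definitions below are convertible to those of Defs. *)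
Section Evaluations.
Variables (C : numFieldType) (A : dpoly C).
Local Notation p := (@dp_prime C A).
Local Notation u_ := (@dp_var C A).

Definition dp_antider (d : A -> A) (a : A) : A :=
  match ClassicalEpsilon.excluded_middle_informative (exists b : A, dp_const b = 0 /\ d b = a) with
  | left h => proj1_sig (ClassicalEpsilon.constructive_indefinite_description _ h)
  | right _ => 0
  end.

Fixpoint dp_Sseq (k : nat) : A :=
  match k with
  | 0 => - ((2%:R)^-1 *: u_ 0)
  | k'.+1 =>
      let s := dp_Sseq k' in
      dp_antider p ((4%:R)^-1 *: p (p (p s))
                     - u_ 0 * p s - (2%:R)^-1 *: (u_ 1 * s))
  end.

Definition dp_S (n : nat) : A := dp_Sseq (n./2).-1.
Definition dp_dflow (n : nat) : A -> A := dp_deriv (fun k => iter k.+1 p (dp_S n.+1)).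
Definition dp_zeta (i j : nat) : A := dp_antider (dp_dflow 1) (dp_dflow i (dp_S j.+1)).
Definition dp_Dact (P : seq nat) (a : A) : A := foldr dp_dflow a P.

Definition dp_Smonomial (a : seq nat) : A :=
  \prod_(t < size a) dp_S (t.*2.+2) ^+ nth 0%N a t.

Definition dp_minor (v : nat * seq nat * seq nat) : A :=
  let: (N, Is, Js) := v in
  ((-1) ^+ ninv (Is ++ compl_desc N Is)) *:
  (let Li := rev (compl_desc N Is) in let Ji := rev Js in
   \det (\matrix_(a < size Js, b < size Js) dp_zeta (nth 0%N Li a) (nth 0%N Ji b))).

Definition dp_surjective (T : Type) (valid : pred T) (gen : T -> A) : Prop :=
  forall x : A, exists l : seq (C * (seq nat * T)),
    all (fun q => Dmon q.2.1 && valid q.2.2) l /\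
    \sum_(q <- l) q.1 *: dp_Dact q.2.1 (gen q.2.2) = x.

Lemma dp_antider_unique (d : A -> A) x b : dp_const b = 0 -> d b = x ->
  (forall b', dp_const b' = 0 -> d b' = d b -> b' = b) -> dp_antider d x = b.
Proof.
move=> cb db uniq; rewrite /dp_antider.
case: ClassicalEpsilon.excluded_middle_informative => [h|]; last by case; exists b.
case: ClassicalEpsilon.constructive_indefinite_description => b' /= [cb' db'].
by apply: uniq => //; rewrite db' db.
Qed.

Variables (s r : fps A).
Hypotheses (sQ : kdv_quadratic s) (sr : s * r = 1).
Local Notation D := (kdv_flow s).
Let pD := @dp_prime_derivation C A.

Lemma dp_SseqE k : dp_Sseq k = s k.+1.
Proof.
elim: k => [|k IH] /=.
  apply: (@dp_mulrn_inj _ _ 1); rewrite (kdv_s1 sQ).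
  by rewrite mulNrn half_mulr2n.
rewrite IH; apply: dp_antider_unique; first by rewrite (kdv_const sQ).
  have q4 (x : A) : ((4%:R : C)^-1 *: x) *+ 4 = x.
    by rewrite -scaler_nat scalerA mulfV ?pnatr_eq0 // scale1r.
  apply: (@dp_mulrn_inj _ _ 3); rewrite (kdv_linear sQ) !mulrnBl q4.
  congr (_ - _); rewrite -[4%N]/(2 * 2)%N [RHS]mulrnA half_mulr2n.
  by rewrite {1}/dp_prime dp_deriv_uvar.
by move=> b' cb'; apply: dp_prime_inj; rewrite cb' (kdv_const sQ).
Qed.

Lemma dp_SE m : (0 < m)%N -> dp_S m.*2 = s m.
Proof. by move=> m0; rewrite /dp_S doubleK dp_SseqE prednK. Qed.

Lemma flow_dp_dflow m a : (0 < m)%N -> D m a = - (2%:R : C) *: dp_dflow m.*2.-1 a.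
Proof.
move=> m0; rewrite -dp_deriv_scale; apply: dp_deriv_ext => k.
by rewrite prednK ?double_gt0 // dp_SE // scaleNr scaler_nat.
Qed.

Lemma dp_dflow_flow m a : (0 < m)%N -> dp_dflow m.*2.-1 a = - (2%:R : C)^-1 *: D m a.
Proof.
move=> m0; rewrite flow_dp_dflow // scalerA mulrNN mulVf ?pnatr_eq0 //.
by rewrite scale1r.
Qed.

(** The first index of zeta numbers the flow, which is the second index of [kdv_zeta], hence the
    exchange. The factors -1/2 in the flows on both sides of the defining equation cancel. *)
Lemma dp_zetaE n m : (0 < n)%N -> (0 < m)%N ->
  dp_zeta m.*2.-1 n.*2.-1 = kdv_zeta s r n m.
Proof.
move=> n0 m0; have d1 x : dp_dflow 1 x = - (2%:R : C)^-1 *: p x.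
  by rewrite -[1%N]/(1.*2.-1)%N dp_dflow_flow // (flow1 sQ).
rewrite /dp_zeta prednK ?double_gt0 // dp_SE //.
apply: dp_antider_unique; first exact: (zeta_const sQ).
  by rewrite d1 (prime_zeta sQ sr) dp_dflow_flow.
move=> b' cb'; rewrite !d1 !scaleNr => /oppr_inj h; apply: dp_prime_inj.
  by rewrite cb' (zeta_const sQ).
apply: (can_inj (fun x => _ : 2%:R *: (2%:R^-1 *: x) = x)) h.
by move=> x; rewrite scalerA mulfV ?pnatr_eq0 // scale1r.
Qed.

Lemma odd_half n : odd n -> exists2 m, (0 < m)%N & n = m.*2.-1.
Proof. by move=> on; exists (n./2.+1) => //; rewrite doubleS /= -{1}(odd_double_half n) on. Qed.

(** The image of a D-linear map is the submodule generated by the images of the generators; the two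
    normalizations of the flows differ by a scalar, absorbed in the coefficients. *)
Lemma dp_surjectiveP (T : Type) (valid : pred T) (gen : T -> A) :
  dp_surjective valid gen <->
  forall x, dspan s (fun y => exists2 t, valid t & y = gen t) x.
Proof.
split=> h x.
  have [l [lv <-]] := h x; elim: l lv => [|[c [P t]] l IH] /=.
    by rewrite big_nil => _; exact: dspan0.
  case/andP=> /andP[Pv tv] /IH IHl; rewrite big_cons; apply: dspanD => //=.
  apply: dspanZ; elim: P Pv => [|n P IHP] /=; first by move=> _; apply: dspan_gen; exists t.
  case/andP=> /odd_half[m m0 ->] /IHP IHm; rewrite dp_dflow_flow //.
  by apply/dspanZ/dspan_flow.
elim: {x}(h x) => [x [t tv ->]||x y _ [k [kv <-]] _ [l [lv <-]]|c x _ [l [lv <-]]|m x m0 _ [l [lv <-]]].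
- by exists [:: (1, ([::], t))]; rewrite /= tv big_seq1 scale1r.
- by exists [::]; rewrite big_nil.
- by exists (k ++ l); rewrite all_cat kv lv big_cat.
- exists [seq (c * q.1, q.2) | q <- l]; rewrite all_map lv big_map scaler_sumr.
  by split=> //; apply: eq_bigr => q _; rewrite scalerA.
exists [seq (- (2%:R : C) * q.1, (m.*2.-1 :: q.2.1, q.2.2)) | q <- l]; split.
  rewrite all_map; apply: sub_all lv => q /= /andP[-> ->]; rewrite !andbT.
  by case: m m0 => // m _; rewrite doubleS /= odd_double.
rewrite big_map (der_sum (flow_derivation s m)); apply: eq_bigr => q _ /=.
by rewrite flowZ flow_dp_dflow // !scalerA mulrC.
Qed.

Lemma dp_Smonomial_widen a N : (size a <= N)%N ->
  dp_Smonomial a = \prod_(t < N) s t.+1 ^+ nth 0%N a t.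
Proof.
move=> aN; rewrite /dp_Smonomial (big_ord_widen _ (fun t => dp_S t.*2.+2 ^+ nth 0%N a t) aN).
rewrite big_mkcond; apply: eq_bigr => t _; rewrite -doubleS dp_SE //.
by case: ltnP => // at_; rewrite nth_default.
Qed.

Lemma dp_SmonomialE a : dp_Smonomial a = \prod_(t < size a) s t.+1 ^+ nth 0%N a t.
Proof. exact: dp_Smonomial_widen. Qed.

Lemma prod_s_mono (l : seq nat) : exists a, \prod_(i <- l) s i = dp_Smonomial a.
Proof.
elim: l => [|[|i] l [a IH]]; first by exists [::]; rewrite big_nil /dp_Smonomial big_ord0.
  by exists a; rewrite big_cons (kdv_s0 sQ) mul1r.
exists (incr_nth a i); rewrite big_cons IH.
pose N := (size a + i).+1.
rewrite (@dp_Smonomial_widen a N) ?(@dp_Smonomial_widen _ N) /N; last 2 first.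
- by rewrite size_incr_nth; case: ifP => _; lia.
- by lia.
have iN : (i < N)%N by rewrite /N; lia.
rewrite (bigD1 (Ordinal iN)) //= [RHS](bigD1 (Ordinal iN)) //= mulrA.
rewrite nth_incr_nth eqxx exprS; congr (_ * _).
apply: eq_bigr => t ti; rewrite nth_incr_nth (_ : (i == t) = false) //.
by apply/negbTE; rewrite eq_sym; exact: ti.
Qed.

(** * Index sets of the generators of ev2 *)

Lemma mem_odds_desc N x : (x \in odds_desc N) = odd x && (x < N.*2)%N.
Proof.
rewrite /odds_desc mem_rev; apply/mapP/andP => [[t]|[ox xN]].
  by rewrite mem_iota => /andP[_ tN] ->; rewrite /= odd_double; split=> //; lia.
exists x./2; first by rewrite mem_iota; lia.
by rewrite -{1}(odd_double_half x) ox.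
Qed.

Lemma odds_desc_sorted N : sorted (fun x y => y < x)%N (odds_desc N).
Proof.
rewrite /odds_desc rev_sorted /mkseq.
apply: (homo_sorted (f := fun t => t.*2.+1) (e := ltn)) (iota_ltn_sorted 0 N).
by move=> x y /= xy; lia.
Qed.

Lemma odds_desc_uniq N : uniq (odds_desc N).
Proof. by rewrite rev_uniq mkseq_uniq // => x y; lia. Qed.

(** Filtering [odds_desc] puts the odd numbers 2 w_i - 1 into the decreasing order that [valid_v]
    demands. *)
Definition odd_support N n (w : 'I_n -> nat) : seq nat :=
  [seq l <- odds_desc N | l \in [seq (w i).*2.-1 | i <- enum 'I_n]].

Lemma perm_odd_support N n (w : 'I_n -> nat) : injective w ->
  (forall i, 0 < w i <= N)%N ->
  perm_eq (odd_support N w) [seq (w i).*2.-1 | i <- enum 'I_n].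
Proof.
move=> w_inj w_le; apply: uniq_perm.
- by rewrite filter_uniq // odds_desc_uniq.
- rewrite map_inj_uniq ?enum_uniq // => i j e; apply: w_inj.
  by have := w_le i; have := w_le j; lia.
move=> x; rewrite mem_filter mem_odds_desc andb_idr // => /mapP[i _ ->].
have := w_le i; case: (w i) => // k; rewrite doubleS /= odd_double; lia.
Qed.

Lemma perm_seq_fun n (w : 'I_n -> nat) (l : seq nat) :
  perm_eq l [seq w i | i <- enum 'I_n] ->
  exists sg : 'S_n, forall i : 'I_n, nth 0%N l i = w (sg i).
Proof.
have -> : [seq w i | i <- enum 'I_n] = [tuple w i | i < n] by [].
by move=> /tuple_permP[sg ->]; exists sg => i; rewrite -tnth_nth !tnth_mktuple.
Qed.

Definition minor_gen : A -> Prop := fun y => exists2 t, valid_v t & y = dp_minor t.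

(** A repeated index gives zero. Otherwise, for N large, the flow indices form the complement of
    some I, and sorting both index lists changes the determinant only by a sign. *)
Lemma zeta_minor_span n (v m : 'I_n -> nat) :
  (forall i, 0 < v i)%N -> (forall j, 0 < m j)%N ->
  xspan s minor_gen (\det (\matrix_(i, j) kdv_zeta s r (v i) (m j))).
Proof.
move=> v0 m0; set Z := \matrix_(i, j) _.
have [v_inj|/injectivePn[i [j ij vij]]] := altP (injectiveP v); last first.
  rewrite (determinant_alternate ij) => [|k]; first exact: xspan0.
  by rewrite !mxE vij.
have [m_inj|/injectivePn[i [j ij mij]]] := altP (injectiveP m); last first.
  rewrite -det_tr (determinant_alternate ij) => [|k]; first exact: xspan0.
  by rewrite !mxE mij.
pose N := (\max_i v i + \max_i m i)%N.
have vN i : (0 < v i <= N)%N.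
  by rewrite v0 (leq_trans (leq_bigmax i)) // leq_addr.
have mN i : (0 < m i <= N)%N.
  by rewrite m0 (leq_trans (leq_bigmax i)) // leq_addl.
pose Js := odd_support N v; pose L := odd_support N m.
pose Is := [seq l <- odds_desc N | l \notin L].
have sizeJ : size Js = n.
  by rewrite (perm_size (perm_odd_support v_inj vN)) size_map size_enum_ord.
have sizeL : size L = n.
  by rewrite (perm_size (perm_odd_support m_inj mN)) size_map size_enum_ord.
have complE : compl_desc N Is = L.
  rewrite /compl_desc /L /odd_support; apply: eq_in_filter => x xN.
  by rewrite mem_filter xN andbT negbK /L mem_filter xN andbT.
have valid : valid_v (N, Is, Js).
  have tr : transitive (fun x y => y < x)%N by move=> x y z xy /ltn_trans; exact.
  rewrite /valid_v !sorted_filter ?odds_desc_sorted //=; apply/and4P; split.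
  - by apply/allP => x; rewrite mem_filter mem_odds_desc => /and3P[].
  - apply/allP => x; rewrite mem_filter mem_odds_desc => /and3P[_ _ xN].
    exact: ltnW.
  - by apply/allP => x; rewrite mem_filter mem_odds_desc => /and3P[].
  rewrite sizeJ -sizeL addnC -complE /compl_desc /Is !size_filter.
  have -> : count (fun l => l \notin [seq l0 <- odds_desc N | l0 \notin L]) (odds_desc N)
     = count (fun l => l \in L) (odds_desc N).
    by apply: eq_in_count => x xN; rewrite mem_filter xN andbT negbK.
  by rewrite (count_predC (fun l => l \in L)) size_rev size_mkseq.
have : xspan s minor_gen (dp_minor (N, Is, Js)) by apply: xspan_gen; exists (N, Is, Js).
rewrite /dp_minor complE.
move: (ninv _) => e /(xspanZ ((-1) ^+ e)); rewrite scalerA -expr2 sqrr_sign scale1r.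
have permr (w : 'I_n -> nat) : injective w -> (forall i, 0 < w i <= N)%N ->
    exists sg : 'S_n, forall i : 'I_n, nth 0%N (rev (odd_support N w)) i = (w (sg i)).*2.-1.
  by move=> wi wN; apply: (perm_seq_fun (w := fun i => (w i).*2.-1)); rewrite perm_rev perm_odd_support.
have [sv hv] := permr v v_inj vN; have [sm hm] := permr m m_inj mN.
suff -> : \det (\matrix_(a < size Js, b < size Js)
    dp_zeta (nth 0%N (rev L) a) (nth 0%N (rev Js) b)) =
    (-1) ^+ (sm (+) sv) * \det Z.
  move=> h; have := xspan_sign (sm (+) sv) h.
  by rewrite mulrA -expr2 sqrr_sign mul1r.
rewrite sizeJ.
transitivity (\det (row_perm sm (col_perm sv Z^T))).
  by congr (\det _); apply/matrixP => i j; rewrite !mxE /L /Js hm hv dp_zetaE.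
rewrite row_permE col_permE !det_mulmx !det_perm det_tr odd_permV signr_addb.
by rewrite -mulrA [_ * \det Z]mulrC mulrA -!mulrA [\det Z * _]mulrC.
Qed.

Lemma size_compl_desc N Is Js : valid_v (N, Is, Js) -> size (compl_desc N Is) = size Js.
Proof.
case/and5P=> Isrt Iodd Ilt _ /andP[_ /eqP sz].
have tr : transitive (fun x y => y < x)%N by move=> x y z xy /ltn_trans; exact.
have Iuniq : uniq Is by apply: sorted_uniq tr _ _ Isrt => x /=; rewrite ltnn.
have pI : perm_eq [seq l <- odds_desc N | l \in Is] Is.
  apply: uniq_perm => // [|x]; first by rewrite filter_uniq // odds_desc_uniq.
  rewrite mem_filter mem_odds_desc andb_idr // => xI.
  (* [valid_v] bounds x by 2N inclusive; parity excludes the value 2N. *)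
  have ox := allP Iodd _ xI; have := allP Ilt _ xI; rewrite ox ltnS leq_eqVlt.
  by case/orP=> // /eqP xN; move: ox; rewrite xN odd_double.
have := count_predC (fun l => l \in Is) (odds_desc N).
rewrite size_rev size_mkseq -size_filter (perm_size pI) -sz /compl_desc size_filter.
exact: addnI.
Qed.

Lemma dp_minorE t : valid_v t -> exists n (v m : 'I_n -> nat) (e : nat),
  [/\ forall i, (0 < v i)%N, forall j, (0 < m j)%N &
      dp_minor t = (-1) ^+ e *: \det (\matrix_(i, j) kdv_zeta s r (v i) (m j))].
Proof.
case: t => -[N Is] Js valid; have sz := size_compl_desc valid.
exists (size Js), (fun i => ((nth 0%N (rev Js) i)./2).+1),
  (fun j => ((nth 0%N (rev (compl_desc N Is)) j)./2).+1), (ninv (Is ++ compl_desc N Is)).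
split=> //; congr (_ *: _); rewrite -[RHS]det_tr; congr (\det _).
apply/matrixP => i j; rewrite !mxE -dp_zetaE //.
have oddE n : odd n -> n = (n./2.+1).*2.-1.
  by move=> on; rewrite doubleS /= -{1}(odd_double_half n) on.
congr dp_zeta; apply: oddE.
  have : nth 0%N (rev (compl_desc N Is)) i \in compl_desc N Is.
    by rewrite -mem_rev mem_nth // size_rev sz.
  by rewrite mem_filter mem_odds_desc => /and3P[].
case/and5P: valid => _ _ _ _ /andP[/allP Jodd _]; apply: Jodd.
by rewrite -mem_rev mem_nth // size_rev.
Qed.

Definition mono_gen : A -> Prop := fun y => exists2 a, xpredT a & y = dp_Smonomial a.

Lemma dp_ev_surjective : dp_surjective xpredT dp_Smonomial <-> dp_surjective valid_v dp_minor.
Proof.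
rewrite !dp_surjectiveP -/mono_gen -/minor_gen.
have hooks n (v m : 'I_n -> nat) : (forall i, 0 < v i)%N -> (forall j, 0 < m j)%N ->
    xspan s minor_gen (\det (\matrix_(i, j) hook s r (v i) (m j))).
  by move=> v0 m0; apply/(det_hook_zeta sQ sr) => //; exact: zeta_minor_span.
have mono_sub y : mono_gen y -> xspan s minor_gen y.
  case=> a _ ->; apply: (spoly_xspan (s := s)) => [l|]; last first.
    rewrite dp_SmonomialE; apply: spoly_prod => i _.
    by elim: (nth _ _ _) => [|k IH]; rewrite ?expr0 ?exprS; [exact: spoly1|apply: spolyM => //; exact: spoly_s].
  rewrite (big_nth 0%N) big_mkord.
  exact: (xspan_s_monomial (jacobi_trudi_hook sQ sr hooks) (fun b : 'I_(size l) => nth 0%N l b)).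
have minor_sub y : minor_gen y -> xspan s mono_gen y.
  case=> t /dp_minorE[n [v [m [e [v0 m0 ->]]]]] ->; apply/xspanZ/(det_hook_zeta sQ sr) => //.
  apply: (spoly_xspan (s := s)) (spoly_det_hook sQ sr v m) => l.
  by have [a ->] := prod_s_mono l; apply: xspan_gen; exists a.
have mono_hom y : mono_gen y -> exists d, hom d y.
  case=> a _ ->; rewrite dp_SmonomialE; eexists; apply: hom_prod => i.
  apply: hom_exp; exact: (hom_s sQ).
have minor_hom y : minor_gen y -> exists d, hom d y.
  case=> t /dp_minorE[n [v [m [e [v0 m0 ->]]]]] ->; eexists; apply: homZ.
  apply: (hom_det (v := fun i => (v i).*2) (w := fun j => (m j).*2 - 2)%N) => i j.
  rewrite mxE; have := hom_zeta sQ sr (v0 i) (m0 j); congr (hom _ _).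
  by rewrite addnBA // -addnn; have := m0 j; lia.
(* Spanning modulo the flows passes from one family to the other; Nakayama then recovers the full
   D-span. *)
split=> h; apply: graded_nakayama => // x; apply: xspan_sub (dspan_xspan (h x)); assumption.
Qed.
End Evaluations.

(** * The monoid algebra as an instance of the interface *)

Section Malg.
Variable C : numFieldType.
Local Notation A := {malg C[{cmonom nat}]}.
Implicit Types (f : nat -> A) (a b g : A) (m : {cmonom nat}).

Definition malg_deriv f g : A :=
  \sum_(m <- msupp g) g@_m *:
     \sum_(i <- finsupp (cmonom_val m)) ((cmonom_val m i)%:R *:
          (<< divcm m (ucm i) >> * f i)).

Definition malg_deriv_mon f m : A :=
  \sum_(i <- finsupp (cmonom_val m)) ((cmonom_val m i)%:R *:
          (<< divcm m (ucm i) >> * f i)).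

Lemma malg_deriv_mmap f g :
  malg_deriv f g = mmap (@malgC {cmonom nat} C) (malg_deriv_mon f) g.
Proof.
rewrite /malg_deriv /mmap; apply: eq_bigr => m _.
by rewrite -[X in X = _]mul_malgC.
Qed.

Lemma malgU_scale c m : << c *g m >> = c *: << m >> :> A.
Proof.
apply/malgP => k; rewrite mcoeffZ [LHS]mcoeffU [X in _ = c * X]mcoeffU.
by rewrite mulrnAr mulr1.
Qed.

Lemma malg_mon1 : << onecm nat >> = 1 :> A. Proof. by []. Qed.

Lemma malg_monM m1 m2 : << mulcm m1 m2 >> = << m1 >> * << m2 >> :> A.
Proof. by rewrite malgM_def (fgmulUU (1 : C) 1 m1 m2) (mulr1 (1 : C)). Qed.

Lemma malg_coefD m a b : (a + b)@_m = a@_m + b@_m.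
Proof. exact: mcoeffD. Qed.

Lemma malg_coefZ m c a : (c *: a)@_m = c * a@_m.
Proof. exact: mcoeffZ. Qed.

Lemma malg_coef_mon m k : (<< k >> : A)@_m = (k == m)%:R.
Proof. exact: mcoeffU1. Qed.

Lemma malg_coef1M a b :
  (a * b)@_(onecm nat) = a@_(onecm nat) * b@_(onecm nat).
Proof. by have [h _] := @mcoeff1g_is_multiplicative {cmonom nat} C; apply: h. Qed.

Lemma malg_ext a b : (forall m, a@_m = b@_m) -> a = b.
Proof. by move=> h; apply/malgP. Qed.

Lemma malg_ind (P : A -> Prop) : (forall c m, P (c *: << m >>)) ->
  (forall a b, P a -> P b -> P (a + b)) -> forall a, P a.
Proof.
move=> PU PD a; rewrite (monalgE a); apply: big_ind => //.
  by have := PU 0 (onecm _); rewrite scale0r.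
by move=> m _; rewrite malgU_scale.
Qed.

Lemma malg_derivD f a b : malg_deriv f (a + b) = malg_deriv f a + malg_deriv f b.
Proof. by rewrite !malg_deriv_mmap mmapD. Qed.

Lemma malg_derivU f c m : malg_deriv f (c *: << m >>) = c *: malg_deriv_mon f m.
Proof. by rewrite malg_deriv_mmap -malgU_scale mmapU mul_malgC. Qed.

Definition malg_dpoly : dpoly C := @DPoly C {malg C[{cmonom nat}]}
  (fun m => << m >>) (fun m a => a@_m) malg_deriv malg_mon1 malg_monM malg_coefD
  malg_coefZ malg_coef_mon malg_coef1M malg_ext malg_ind malg_derivD malg_derivU.
End Malg.

(** * Identification with the original definitions *)

Section Bridge.
Variable R : rcfType.
Local Notation B := (malg_dpoly (complex R)).

Lemma antiderB : @antider R = @dp_antider _ B. Proof. by []. Qed.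
Lemma SB : @S R = @dp_S _ B. Proof. by []. Qed.
Lemma dflowB : @dflow R = @dp_dflow _ B. Proof. by []. Qed.
Lemma zetaB : @zeta R = @dp_zeta _ B.
Proof. by rewrite /zeta antiderB dflowB SB; reflexivity. Qed.
Lemma DactB : @Dact R = @dp_Dact _ B. Proof. by rewrite /Dact dflowB. Qed.

Lemma ev1_genB x : ev1_gen R x = dp_Dact (A := B) x.1 (dp_Smonomial B x.2).
Proof. by rewrite /ev1_gen DactB SB; reflexivity. Qed.

Lemma ev2_genB x : ev2_gen R x = dp_Dact (A := B) x.1 (dp_minor B x.2).
Proof.
case: x => P [[N Is] Js].
by rewrite /ev2_gen DactB /zeta_det zetaB; reflexivity.
Qed.
Lemma ev1B l : ev1 l = \sum_(q <- l) q.1 *: dp_Dact q.2.1 (dp_Smonomial B q.2.2) :> B.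
Proof. by rewrite /ev1; apply: eq_bigr => q _; rewrite ev1_genB; reflexivity. Qed.

Lemma ev2B l : ev2 l = \sum_(q <- l) q.1 *: dp_Dact q.2.1 (dp_minor B q.2.2) :> B.
Proof. by rewrite /ev2; apply: eq_bigr => q _; rewrite ev2_genB; reflexivity. Qed.
End Bridge.

Theorem theorem3 (R : rcfType) : ev1_surjective R <-> ev2_surjective R.
Proof.
have [s sQ] := kdv_quadratic_exists (malg_dpoly (complex R)).
have [r sr] := fps_inv_exists (kdv_s0 sQ).
have key := dp_ev_surjective sQ sr.
have e1 : ev1_surjective R <-> dp_surjective xpredT (@dp_Smonomial _ (malg_dpoly (complex R))).
  split=> h x; have [l [lv lx]] := h x; exists l; split.
  - by apply: sub_all lv => q ->.
  - by rewrite -ev1B; exact: lx.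
  - by apply: sub_all lv => q /andP[].
  - by rewrite ev1B; exact: lx.
have e2 : ev2_surjective R <-> dp_surjective valid_v (@dp_minor _ (malg_dpoly (complex R))).
  split=> h x; have [l [lv lx]] := h x; exists l; split; try exact: lv.
  - by rewrite -ev2B; exact: lx.
  - by rewrite ev2B; exact: lx.
by rewrite e1 e2.
Qed.
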